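(* Let $G$ be a perfect graph on $d-1$ vertices, where $d\geq 1$, and let $P=\mathrm{Hans}(G)$ be its Hansen polytope, which is $d$-dimensional. Then $f_0(P)f_{d-1}(P)\leq d2^{d+1}$, and equality holds if and only if $P$ is affinely isomorphic to the $d$-dimensional cube or the $d$-dimensional cross-polytope.
   Context: For a $d$-dimensional polytope $P$, $f_0(P)$ is its number of vertices and $f_{d-1}(P)$ its number of facets. The $d$-dimensional cube is $[-1,1]^d$ and the $d$-dimensional cross-polytope is its polar. Graphs are finite and simple. $\mathrm{STAB}(G)$ is the convex hull of the characteristic vectors of all stable sets of $G$ (including the empty one). The twisted prism of a $(d-1)$-dimensional polytope $Q\subseteq\mathbb{R}^{d-1}$ is the convex hull of $\{(x,1):x\in Q\}\cup\{(-x,-1):x\in Q\}$. The Hansen polytope $\mathrm{Hans}(G)$ of a perfect graph $G$ is the twisted prism of $\mathrm{STAB}(G)$. *)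

(* Defs.v *)
From HB Require Import structures.
From mathcomp Require Import all_boot all_order all_algebra finmap.
From mathcomp Require Import boolp classical_sets functions cardinality reals.

Set Implicit Arguments.
Unset Strict Implicit.
Unset Printing Implicit Defensive.

Import Order.TTheory GRing.Theory Num.Theory.

Local Open Scope classical_set_scope.
Local Open Scope ring_scope.

Record sgraph := SGraph {
  vert :> finType;
  adj : rel vert;
  adj_sym : symmetric adj;
  adj_irr : irreflexive adj }.

Definition stable (G : sgraph) (S : {set G}) : bool :=
  [forall x in S, forall y in S, ~~ adj x y].

Definition clique (G : sgraph) (K : {set G}) : bool :=
  [forall x in K, forall y in K, (x != y) ==> adj x y].

Definition clique_number (G : sgraph) : nat :=
  \max_(K : {set G} | clique K) #|K|.

Definition colorable (G : sgraph) (k : nat) : bool :=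
  [exists c : {ffun G -> 'I_k},
    [forall x, forall y, adj x y ==> (c x != c y)]].

Lemma colorable_card (G : sgraph) : exists k, colorable G k.
Proof.
exists #|vert G|; apply/existsP; exists [ffun x => enum_rank x].
apply/forallP => x; apply/forallP => y; apply/implyP; rewrite !ffunE => xy.
by apply/eqP => /enum_rank_inj exy; move: xy; rewrite exy adj_irr.
Qed.

Definition chromatic_number (G : sgraph) : nat := ex_minn (colorable_card G).

Definition induced (G : sgraph) (W : {set G}) : sgraph :=
  @SGraph {x : G | x \in W} (fun u v => adj (val u) (val v))
    (fun u v => adj_sym (val u) (val v)) (fun u => adj_irr (val u)).

Definition perfect (G : sgraph) : Prop :=
  forall W : {set G},
    chromatic_number (induced W) = clique_number (induced W).

Definition dotp (R : realType) (m : nat) (x y : 'rV[R]_m) : R :=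
  \sum_(i < m) x 0 i * y 0 i.

Definition conv_hull (R : realType) (m : nat) (A : set 'rV[R]_m) :
    set 'rV[R]_m :=
  [set x | exists (n : nat) (c : 'I_n -> R) (p : 'I_n -> 'rV[R]_m),
    [/\ forall i, A (p i), forall i, 0 <= c i, \sum_i c i = 1
      & x = \sum_i c i *: p i]].

Definition aff_hull (R : realType) (m : nat) (A : set 'rV[R]_m) :
    set 'rV[R]_m :=
  [set x | exists (n : nat) (c : 'I_n -> R) (p : 'I_n -> 'rV[R]_m),
    [/\ forall i, A (p i), \sum_i c i = 1 & x = \sum_i c i *: p i]].

(* The affine hull of A is a translate of a k-dimensional linear subspace; the
   empty set has no dimension in this sense. *)
Definition has_dim (R : realType) (m : nat) (A : set 'rV[R]_m) (k : nat) :
    Prop :=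
  exists (x : 'rV[R]_m) (L : {vspace 'rV[R]_m}),
    aff_hull A = [set x + v | v in [set v | v \in L]] /\ \dim L = k.

(* Both P (take a = 0, b = 0) and the empty set (a = 0, b = 1) are faces. *)
Definition face (R : realType) (m : nat) (P F : set 'rV[R]_m) : Prop :=
  exists (a : 'rV[R]_m) (b : R),
    (forall x, P x -> dotp a x <= b) /\ F = P `&` [set x | dotp a x = b].

(* The number of k-dimensional faces of P.  fset_set is empty on infinite sets,
   but a polytope has only finitely many faces. *)
Definition face_number (R : realType) (m : nat) (P : set 'rV[R]_m) (k : nat) :
    nat :=
  #|` fset_set [set F : set 'rV[R]_m | face P F /\ has_dim F k]|%fset.

(* Coordinates are indexed by the vertices of G in their enumeration order. *)
Definition char_vec (R : realType) (G : sgraph) (S : {set G}) :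
    'rV[R]_#|vert G| :=
  \row_i (enum_val i \in S)%:R.

Definition STAB (R : realType) (G : sgraph) : set 'rV[R]_#|vert G| :=
  conv_hull [set char_vec R S | S in [set S : {set G} | stable S]].
Arguments STAB : clear implicits.

Definition twisted_prism (R : realType) (n : nat) (Q : set 'rV[R]_n) :
    set 'rV[R]_(n + 1) :=
  conv_hull ([set row_mx x (const_mx 1) | x in Q]
         `|` [set row_mx (- x) (const_mx (- 1)) | x in Q]).

Definition Hans (R : realType) (G : sgraph) : set 'rV[R]_(#|vert G| + 1) :=
  twisted_prism (STAB R G).
Arguments Hans : clear implicits.

Definition cube (R : realType) (d : nat) : set 'rV[R]_d :=
  [set x | forall i, -1 <= x 0 i <= 1].
Arguments cube : clear implicits.

Definition polar (R : realType) (m : nat) (A : set 'rV[R]_m) : set 'rV[R]_m :=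
  [set y | forall x, A x -> dotp x y <= 1].

Definition cross_polytope (R : realType) (d : nat) : set 'rV[R]_d :=
  polar (cube R d).
Arguments cross_polytope : clear implicits.

Definition aff_isomorphic (R : realType) (m k : nat)
    (P : set 'rV[R]_m) (Q : set 'rV[R]_k) : Prop :=
  exists (M : 'M[R]_(m, k)) (b : 'rV[R]_k),
    set_bij P Q (fun x => x *m M + b).

(* Main.v *)
Require Import Defs.
From mathcomp Require Import all_boot all_order all_algebra.
From mathcomp Require Import zify ring lra.

(** Let [n = d - 1] be the number of vertices of [G], [s] the number of its
stable sets and [c] the number of its cliques, both counted with the empty
set.

The polytope [P] is the convex hull of the points [(chi_S, 1)] and their
antipodes, for [S] stable.  Each of them is exposed ([gen_exposed]), so
[f_0 = 2 s].  Its facets are given by the inequalities [2 x(K) - t <= 1] and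
their antipodes, for [K] a clique, so [f_(d-1) = 2 c].  On the one hand each
such inequality is valid, because a clique meets a stable set at most once, and
it is tight at [d] linearly independent generators ([aff_hull_facet]).  On the
other hand a facet has no other supporting functional ([facetE]).  This is where
perfection enters, in the form of the weighted colouring theorem: integer
weights with clique sums at most [N] are covered exactly by [N] stable sets
([perfect_colouring], by Lovász replication).  A facet is compared with the
clique constraints at the sum of its generators, which is an integer point, so
integer weights suffice and no limit or separation argument occurs
([facet_clique]).

It remains to show [s * c <= (n + 1) * 2 ^ n], which holds for every graph
([stables_cliques_le]).  Count the pairs of a stable set [S] and a clique [K] by
their union [U].  If they meet, it is in one vertex [v], and [(U, v)] determines
the pair; so there are at most [#|U|] such pairs.  If they are disjoint, they
form a split partition of [U], and there are at most [#|U| + 1] of these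
([card_split_cliques]).  Summing [2 * #|U| + 1] over all [U] gives the bound.
Equality forces [G] to be edgeless or complete ([stables_cliques_eq]), and then
[P] is a cube or a cross-polytope up to a linear map ([edgeless_cube],
[complete_cross]).  Conversely, if [P] is isomorphic to the cube, it has as many
extreme points as the Hansen polytope of the edgeless graph, which is isomorphic
to the cube too; so every set is stable and [G] is edgeless.  The cross-polytope
is treated in the same way with the complete graph. *)

Set Implicit Arguments.
Unset Strict Implicit.
Unset Printing Implicit Defensive.

Import Order.TTheory GRing.Theory Num.Theory.

(** * Weighted colourings of a perfect graph *)

Section Colourings.
Variable G : sgraph.
Implicit Types (S K U : {set G}) (v x y : G).

Lemma stableP S :
  reflect (forall x y, x \in S -> y \in S -> ~~ adj x y) (stable S).
Proof.
apply: (iffP forall_inP) => [H x y xS yS|H x xS].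
  by move/forall_inP: (H x xS); apply.
by apply/forall_inP => y; apply: H.
Qed.

Lemma cliqueP K :
  reflect (forall x y, x \in K -> y \in K -> x != y -> adj x y) (clique K).
Proof.
apply: (iffP forall_inP) => [H x y xK yK|H x xK].
  by move/forall_inP: (H x xK) => /(_ y yK) /implyP.
by apply/forall_inP => y yK; apply/implyP; apply: H.
Qed.

Lemma stable_sub S S' : S' \subset S -> stable S -> stable S'.
Proof.
move=> /subsetP sub /stableP H; apply/stableP => x y xS yS.
by apply: H; apply: sub.
Qed.

Lemma clique_sub K K' : K' \subset K -> clique K -> clique K'.
Proof.
move=> /subsetP sub /cliqueP H; apply/cliqueP => x y xS yS.
by apply: H; apply: sub.
Qed.

Lemma card_le1_eq (S : {set G}) x y : #|S| <= 1 -> x \in S -> y \in S -> x = y.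
Proof. by move=> /card_le1_eqP H xS yS; apply: H. Qed.

Lemma stable_card_le1 S : #|S| <= 1 -> stable S.
Proof.
move=> S1; apply/stableP => x y xS yS.
by rewrite (card_le1_eq S1 xS yS) adj_irr.
Qed.

Lemma clique_card_le1 K : #|K| <= 1 -> clique K.
Proof.
move=> K1; apply/cliqueP => x y xK yK.
by rewrite (card_le1_eq K1 xK yK) eqxx.
Qed.

Lemma stable_clique_meet S K : stable S -> clique K -> #|S :&: K| <= 1.
Proof.
move=> /stableP sS /cliqueP cK; apply/card_le1_eqP => x y.
rewrite !inE => /andP[xS xK] /andP[yS yK]; apply/eqP; apply: contraT => xy.
by have := sS _ _ yS xS; rewrite cK // eq_sym.
Qed.

(** A colouring may repeat a stable set, so the family is a sequence and the
weight of [v] is the number of its members through [v]. *)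
Definition colouring (w : G -> nat) (l : seq {set G}) :=
  all (@stable G) l /\ forall v, count (fun S => v \in S) l = w v.

Lemma colouring_weight w l K :
  colouring w l -> \sum_(v in K) w v = \sum_(S <- l) #|S :&: K|.
Proof.
case=> _ cl; under eq_bigr do rewrite -cl -sum1_count.
rewrite (exchange_big_dep xpredT) //=; apply: eq_bigr => S _.
by rewrite -sum1_card; apply: eq_bigl => v; rewrite inE andbC.
Qed.

(** For 0/1 weights the clique bound is a bound on the clique number of the
subgraph induced by the support, and perfection turns it into a proper
colouring, whose classes are padded with empty sets. *)
Lemma perfect_support_colouring (w : G -> nat) N :
  perfect G -> (forall v, w v <= 1) ->
  (forall K, clique K -> \sum_(v in K) w v <= N) ->
  exists2 l, size l = N & colouring w l.
Proof.
move=> perfG w1 wN; pose W := [set v | 0 < w v].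
have wE v : w v = (v \in W) by rewrite inE; have := w1 v; lia.
have : colorable (induced W) (chromatic_number (induced W)).
  by rewrite /chromatic_number; case: ex_minnP.
have : chromatic_number (induced W) <= N.
  rewrite perfG /clique_number; apply/bigmax_leqP => K cK.
  pose K' : {set G} := [set val u | u in K].
  have cK' : clique K'.
    apply/cliqueP => x y /imsetP[u uK ->] /imsetP[u' uK' ->] uu'.
    move/forall_inP: cK => /(_ u uK) /forall_inP /(_ u' uK') /implyP; apply.
    by apply: contraNneq uu' => ->.
  apply: leq_trans (wN _ cK').
  rewrite -(card_imset _ val_inj) -sum1_card leq_sum // => x /imsetP[u _ ->].
  by have := valP u; rewrite inE.
move: (chromatic_number _) => k kN /existsP[c /forallP col].
pose cls (j : 'I_k) : {set G} := [set val u | u in [set u | c u == j]].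
exists ([seq cls j | j : 'I_k] ++ nseq (N - k) set0).
  by rewrite size_cat size_map -cardT card_ord size_nseq subnKC.
split.
  rewrite all_cat; apply/andP; split; last first.
    by rewrite all_nseq stable_card_le1 ?orbT ?cards0.
  apply/allP => _ /mapP[j _ ->]; apply/stableP => x y.
  move=> /imsetP[u]; rewrite inE => /eqP cu -> /imsetP[u']; rewrite inE.
  move=> /eqP cu' ->; apply/negP => uu'.
  by move/forallP: (col u) => /(_ u') /implyP /(_ uu'); rewrite cu cu' eqxx.
move=> v; rewrite count_cat count_nseq in_set0 mul0n addn0 count_map wE.
case: (boolP (v \in W)) => vW.
  transitivity (count_mem (c (Sub v vW)) (enum 'I_k)); last first.
    by rewrite count_uniq_mem ?enum_uniq // mem_enum.
  apply: eq_count => j /=.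
  apply/imsetP/eqP => [[u]|->].
    by rewrite inE => /eqP <- vu; congr (c _); apply: val_inj; rewrite SubK.
  by exists (Sub v vW); rewrite ?inE ?SubK.
apply/eqP; rewrite -leqn0 leqNgt -has_count; apply/hasPn => j _ /=.
by apply: contra vW => /imsetP[u _ ->]; apply: valP.
Qed.

(** Lovász replication, phrased with weights instead of replicated vertices.
Lower a weight [w v >= 2] by one, to [w'], and colour [w'] with [N] stable
sets; one of them, [S], contains [v].  A clique of [w']-weight [N] meets every
class, and avoids [v] because its [w]-weight is at most [N]; so [S :\ v] meets
it, and removing [S :\ v] from [w'] leaves weights for which [N - 1] classes
suffice.  Adding [S] back restores both [S :\ v] and the missing unit at [v]. *)
Lemma perfect_colouring (w : G -> nat) N :
  perfect G -> (forall K, clique K -> \sum_(v in K) w v <= N) ->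
  exists2 l, size l = N & colouring w l.
Proof.
move=> perfG; have [m] := ubnP (\sum_v w v).
elim: m w N => // m IH w N; rewrite ltnS => wm wN.
have [w1|] := boolP [forall v, w v <= 1].
  by apply: perfect_support_colouring => //; apply/forallP.
rewrite negb_forall => /existsP[v]; rewrite -ltnNge => wv.
pose w' u := w u - (u == v).
have w'K K : \sum_(u in K) w u = \sum_(u in K) w' u + (v \in K).
  have -> : (v \in K : nat) = \sum_(u in K) (u == v).
    case: (boolP (v \in K)) => vK.
      by rewrite (bigD1 v) //= eqxx big1 // => u /andP[_ /negPf ->].
    by rewrite big1 // => u uK; case: eqP uK vK => // -> ->.
  by rewrite -big_split; apply: eq_bigr => u _ /=; rewrite /w';
    case: eqP => [->|_] /=; lia.

have [l sl [stl cl]] : exists2 l, size l = N & colouring w' l.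
  apply: IH => [|K cK]; last by have := wN K cK; rewrite w'K; lia.
  apply: leq_trans wm; have := w'K [set: G]; rewrite in_setT.
  rewrite (eq_bigl xpredT) => [|u]; last exact: in_setT.
  rewrite [in X in _ = X -> _](eq_bigl xpredT) => [->|u]; last exact: in_setT.
  by rewrite addn1.
have w'v : w' v = (w v).-1 by rewrite /w' eqxx subn1.
have /hasP[S Sl vS] : has (fun S => v \in S) l by rewrite has_count cl w'v; lia.
have stS : stable S by move/allP: stl; apply.
have sl' : size (rem S l) = N.-1 by rewrite size_rem // sl.
have N0 : 0 < N by rewrite -sl; case: (l) Sl.
pose w2 u := w' u - ((u \in S) && (u != v)).
have w'S u : u \in S -> 0 < w' u.
  by move=> uS; rewrite -cl -has_count; apply/hasP; exists S.
have w2E u : w' u = w2 u + ((u \in S) && (u != v)).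
  by rewrite /w2; case: (boolP (u \in S)) => [/w'S|_] /=;
    [case: (u != v) => /=|]; lia.
have w2K K : \sum_(u in K) w' u = \sum_(u in K) w2 u + #|(S :\ v) :&: K|.
  rewrite -sum1_card big_mkcond [\sum_(u in _ :&: _) _]big_mkcond.
  rewrite [\sum_(u in K) w2 u]big_mkcond -big_split; apply: eq_bigr => u _ /=.
  by rewrite !inE w2E; case: (u \in K); case: (u \in S); case: (u == v) => //=;
    lia.
have [l2 sl2 [stl2 cl2]] : exists2 l, size l = N.-1 & colouring w2 l.
  apply: IH => [|K cK].
    apply: leq_trans wm; rewrite [X in _ < X](bigD1 v) //= [X in X < _](bigD1
      v) //=.
    rewrite -addSn leq_add //; first by have := w2E v; lia.
    apply: leq_sum => u uv; have := w2E u; rewrite /w' (negPf uv); lia.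
  have wK := wN K cK; rewrite w'K w2K in wK.
  have [vK|vK] := boolP (v \in K).
    by move: wK; rewrite vK; lia.
  (* v is not in K, so S loses nothing on K and the other N - 1 classes
     account for the rest of the weight *)
  have -> : \sum_(u in K) w2 u = \sum_(u in K) w' u - #|S :&: K|.
    rewrite w2K; have -> : (S :\ v) :&: K = S :&: K.
      apply/setP => u; rewrite !inE; have [->|//] := eqVneq u v.
      by rewrite (negPf vK) !andbF.
    by rewrite addnK.
  rewrite (colouring_weight K (conj stl cl)) (perm_big _ (perm_to_rem Sl)).
  rewrite big_cons addKn -sl' -sum1_size big_seq [X in _ <= X]big_seq.
  apply: leq_sum => T /mem_rem Tl; apply: stable_clique_meet => //.
  by move/allP: stl; apply.
exists (S :: l2); first by rewrite /= sl2 prednK.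
split; first by rewrite /= stS.
move=> u; rewrite /= cl2; have := w2E u; have := w'S u.
rewrite /w'; case: eqP => [->|_] /=; last by lia.
by rewrite vS; lia.
Qed.
End Colourings.

(** * Counting stable sets and cliques *)

Definition stables (G : sgraph) := [set S : {set G} | stable S].
Definition cliques (G : sgraph) := [set K : {set G} | clique K].
Definition edgeless (G : sgraph) := forall x y : G, ~~ adj x y.
Definition complete (G : sgraph) := forall x y : G, x != y -> adj x y.

Section Counting.
Variable G : sgraph.
Implicit Types (S K U : {set G}) (v x y : G).

Definition nbrs v : {set G} := [set u | adj v u].

Definition split_cliques U : {set {set G}} :=
  [set K in cliques G | (K \subset U) && stable (U :\: K)].

(** Adding a vertex [v] to [U] creates at most one new split partition: a
partition of [U :\ v] can receive [v] on either side only if its clique part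
is exactly the set of neighbours of [v] in [U]. *)
Lemma card_split_cliques U : #|split_cliques U| <= #|U|.+1.
Proof.
have [m] := ubnP #|U|; elim: m U => // m IH U; rewrite ltnS => Um.
have [->|[v vU]] := set_0Vmem U.
  rewrite cards0 -(cards1 (set0 : {set G})) subset_leq_card //.
  by apply/subsetP => K; rewrite !inE subset0 => /and3P[].
have Uv : #|U| = #|U :\ v|.+1 by rewrite (cardsD1 v) vU.
have := IH (U :\ v); rewrite -Uv => /(_ Um) IHv.
pose A1 := [set K in split_cliques U | v \in K].
pose A0 := split_cliques U :\: A1.
pose B := [set K :\ v | K in A1].
have cB : #|B| = #|A1|.
  apply: card_in_imset => K K'; rewrite !inE => /andP[_ vK] /andP[_ vK'] e.
  by rewrite -(setD1K vK) -(setD1K vK') e.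
have sA1 : A1 \subset split_cliques U by apply/subsetP => K /setIdP[].
rewrite -(cardsID A1) (setIidPr sA1) -cB -/A0 -cardsUI.
have -> : #|U|.+1 = #|U| + 1 by rewrite addn1.
apply: leq_add.
  apply: leq_trans IHv; rewrite subset_leq_card // subUset.
  apply/andP; split; apply/subsetP => K.
    case/imsetP => K'; rewrite !inE => /andP[/and3P[cK' K'U sK'] vK'] ->.
    rewrite (clique_sub (subsetDl _ _) cK') setSD //=.
    by apply: stable_sub sK'; apply/subsetP => u; rewrite !inE; case: (u == v);
      rewrite //= andbT.
  rewrite !inE negb_and => /andP[/orP[/negP//|vK] /and3P[cK KU sK]].
  rewrite cK subsetD1 KU vK /=.
  by apply: stable_sub sK; apply: setSD; apply: subsetDl.
rewrite -(cards1 (nbrs v :&: U)) subset_leq_card //; apply/subsetP => K.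
rewrite in_setI => /andP[/imsetP[K1]].
rewrite !inE => /andP[/and3P[cK1 K1U sK1] vK1] ->.
move=> /and4P[_ _ _ /stableP sK].
apply/eqP/setP => u; rewrite !inE.
have [->|uv] := eqVneq u v; first by rewrite adj_irr.
apply/idP/idP => /= [uK|/andP[vu uU]].
  by rewrite (subsetP K1U) // andbT; move/cliqueP: cK1; apply;
    rewrite // eq_sym.
apply: contraT => uK; have := sK v u;
  rewrite !inE eqxx vU uU (negPf uK) andbF vu /=.
by move/(_ isT isT).
Qed.

Definition pairs : {set {set G} * {set G}} := setX (stables G) (cliques G).

Lemma card_pairs : #|pairs| = #|stables G| * #|cliques G|.
Proof. exact: cardsX. Qed.

Definition disj_pairs := [set p in pairs | p.1 :&: p.2 == set0].

Definition meet_pairs := pairs :\: disj_pairs.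

(** A disjoint pair is a split partition of its union. *)
Lemma card_disj_pairs : #|disj_pairs| <= \sum_(U : {set G}) #|U|.+1.
Proof.
apply: leq_trans (_ : \sum_(U : {set G}) #|split_cliques U| <= _); last first.
  by apply: leq_sum => U _; apply: card_split_cliques.
rewrite -sum1_card (partition_big (fun p : {set G} * {set G} => p.1 :|: p.2)
  xpredT) //=.
apply: leq_sum => U _; rewrite sum1_card.
rewrite -(card_in_imset (f := snd)); last first.
  move=> [S K] [S' K'] /andP[/= + /eqP e] /andP[/= + /eqP e'] /= KK.
  rewrite !inE /= => /andP[_ /eqP d] /andP[_ /eqP d']; congr pair => //.
  have D (A B : {set G}) : A :&: B = set0 -> A = (A :|: B) :\: B.
    move=> dAB; apply/setP => u; move/setP: dAB => /(_ u); rewrite !inE.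
    by case: (u \in A); case: (u \in B).
  by rewrite (D S K) // (D S' K') // e e' KK.
apply: subset_leq_card; apply/subsetP => K /imsetP[[S K']].
rewrite -topredE /= !inE /= => /andP[/andP[/andP[sS cK] _] /eqP <-] ->.
rewrite cK subsetUr /=; apply: stable_sub sS; apply/subsetP => u.
by rewrite !inE; case: (u \in K'); rewrite //= orbF.
Qed.

Definition pointed := [set p : {set G} * G | p.2 \in p.1].

(** The only candidate for a pair [(S, K)] with union [U] and common vertex [v]:
the other vertices of [U] lie in [K] or in [S] according to their adjacency
to [v]. *)
Definition pair_of (p : {set G} * G) : {set G} * {set G} :=
  (p.1 :\: nbrs p.2, p.2 |: (nbrs p.2 :&: p.1)).

Lemma meet_pairs_sub : meet_pairs \subset pair_of @: pointed.
Proof.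
apply/subsetP => -[S K]; rewrite !inE /= => /andP[+ /andP[sS cK]].
rewrite sS cK /= => /set0Pn[v]; rewrite inE => /andP[vS vK].
apply/imsetP; exists (S :|: K, v); first by rewrite !inE /= vS.
move/stableP: sS => sS; move/cliqueP: cK => cK.
congr pair => /=; apply/setP => u; rewrite !inE.
  have [uS|uS] := boolP (u \in S); first by rewrite sS.
  have [uK|uK] := boolP (u \in K); rewrite /= ?andbF ?andbT //.
  by rewrite cK //; apply: contraNneq uS => <-.
have [->|uv] := eqVneq u v; first by rewrite vK.
have [uK|uK] := boolP (u \in K); first by rewrite cK ?orbT // eq_sym.
rewrite orbF; have [uS|uS] := boolP (u \in S); rewrite ?andbF // andbT.
by apply/esym/negbTE; apply: sS.
Qed.

Lemma card_pointed : #|pointed| = \sum_(U : {set G}) #|U|.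
Proof.
rewrite -sum1_card (partition_big fst xpredT) //=; apply: eq_bigr => U _.
rewrite sum1_card -(card_in_imset (f := snd)); last first.
  by move=> [A v] [B u] /andP[_ /= /eqP ->] /andP[_ /= /eqP ->] /= ->.
apply: eq_card => v; apply/imsetP/idP => [[[A u]]|vU].
  by rewrite -topredE /= inE /= => /andP[uA /eqP <-] ->.
by exists (U, v) => //; rewrite -topredE /= inE /= vU eqxx.
Qed.

Lemma card_sets : #|{set G}| = 2 ^ #|G|.
Proof. by rewrite -[LHS]cardsT -powersetT card_powerset cardsT. Qed.

Lemma sum_card_sets : \sum_(U : {set G}) (#|U| + #|U|.+1) = #|G|.+1 * 2 ^ #|G|.
Proof.
rewrite (eq_bigr (fun U : {set G} => (#|U| + #|U|) + 1)); last by move=> *; lia.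
rewrite big_split big_split /=.
rewrite [X in _ + X + _](reindex_inj (inv_inj (@setCK G))) /= -big_split /=.
rewrite (eq_bigr (fun=> #|G|)) => [|U _]; last by rewrite cardsC.
by rewrite !sum_nat_const card_sets muln1 -mulnSr mulnC.
Qed.

Lemma stables_cliques_le : #|stables G| * #|cliques G| <= #|G|.+1 * 2 ^ #|G|.
Proof.
rewrite -card_pairs -sum_card_sets big_split /=.
have sd : disj_pairs \subset pairs by apply/subsetP => p /setIdP[].
rewrite -(cardsID disj_pairs) (setIidPr sd) addnC.
apply: leq_add card_disj_pairs; rewrite -card_pointed.
exact: leq_trans (subset_leq_card meet_pairs_sub) (leq_imset_card _ _).
Qed.

(** Equality forces every [pair_of (U, v)] to be a stable set and a clique.  For
[U] the whole vertex set: the closed neighbourhood of each vertex is a clique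
and its non-neighbours are stable.  If [adj a b], a vertex [c] not adjacent to
[a] cannot be adjacent to [b] (look at [b]) nor non-adjacent (look at [c]), so
[a] is adjacent to everything and its closed neighbourhood is all of [G]. *)
Lemma stables_cliques_eq :
  #|stables G| * #|cliques G| = #|G|.+1 * 2 ^ #|G| -> edgeless G \/ complete G.
Proof.
rewrite -card_pairs -sum_card_sets big_split /= => e.
have sd : disj_pairs \subset pairs by apply/subsetP => p /setIdP[].
move: e; rewrite -(cardsID disj_pairs) (setIidPr sd) addnC -card_pointed.
move=> e; have cd := card_disj_pairs.
have ci : #|pair_of @: pointed| <= #|meet_pairs|.
  apply: leq_trans (leq_imset_card _ _) _.
  by rewrite -(leq_add2r #|disj_pairs|) e leq_add2l.
have im : meet_pairs = pair_of @: pointed.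
  by apply/eqP; rewrite eqEcard meet_pairs_sub ci.
have H v : stable (~: nbrs v) && clique (v |: nbrs v).
  have : pair_of ([set: G], v) \in meet_pairs by rewrite im imset_f // inE
    in_setT.
  by rewrite !inE /pair_of /= setTD setIT => /andP[].
have [|ne] := boolP [exists a : G, [exists b : G, adj a b]].
  case/existsP=> a /existsP[b ab].
  right; have all_a c : c != a -> adj a c.
    move=> ca; apply: contraT => nac.
    have /andP[_ /cliqueP cb] := H b.
    have nbc : ~~ adj b c.
      apply: contra nac => bc; apply: cb; rewrite ?inE ?bc ?orbT //.
        by rewrite adj_sym ab orbT.
      by rewrite eq_sym.
    have /andP[/stableP sc _] := H c.
    have := sc a b; rewrite !inE !(adj_sym c) nac nbc ab.
    by move/(_ isT isT).
  move=> x y xy; have /andP[_ /cliqueP ca] := H a.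
  by apply: ca => //; rewrite !inE; have [//|/all_a] := eqVneq.
left=> x y; apply: contra ne => xy.
by apply/existsP; exists x; apply/existsP; exists y.
Qed.

Lemma card_small_sets : #|[set S : {set G} | #|S| <= 1]| = #|G|.+1.
Proof.
have -> : [set S : {set G} | #|S| <= 1] = set0 |: [set [set v] | v in [set: G]].
  apply/setP => S; rewrite !inE -cards_eq0.
  have -> : (S \in [set [set v] | v in [set: G]]) = (#|S| == 1).
    apply/imsetP/cards1P => [[v _ ->]|[v ->]]; first by exists v.
    by exists v; rewrite ?in_setT.
  by case: #|S| => [|[]].
rewrite cardsU1 card_imset ?cardsT; last exact: set1_inj.
case: imsetP => // -[v _ /setP /(_ v)]; by rewrite !inE eqxx.
Qed.

Lemma edgeless_stables : edgeless G <-> #|stables G| = 2 ^ #|G|.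
Proof.
rewrite -card_sets.
split=> [e|/eqP].
  by rewrite -cardsT; apply: eq_card => S; rewrite !inE; apply/stableP.
rewrite -cardsT => e x y; have : stables G = [set: {set G}].
  by apply/eqP; rewrite eqEcard subsetT (eqP e) leqnn.
move/setP => /(_ [set x; y]); rewrite !inE => /stableP; apply;
  by rewrite !inE eqxx ?orbT.
Qed.

Lemma edgeless_cliques : edgeless G -> #|cliques G| = #|G|.+1.
Proof.
move=> e; rewrite -card_small_sets; apply: eq_card => K; rewrite !inE.
apply/idP/idP; last exact: clique_card_le1.
move=> /cliqueP cK; apply/card_le1_eqP => x y xK yK; apply/eqP.
by apply: contraT => xy; move: (e y x); rewrite cK.
Qed.

Lemma complete_cliques : complete G -> #|cliques G| = 2 ^ #|G|.
Proof.
move=> c; rewrite -card_sets -cardsT; apply: eq_card => K; rewrite !inE.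
by apply/cliqueP => x y _ _; apply: c.
Qed.

Lemma complete_stables : complete G <-> #|stables G| = #|G|.+1.
Proof.
rewrite -card_small_sets; split=> [c|e].
  apply: eq_card => S; rewrite !inE.
  apply/idP/idP; last exact: stable_card_le1.
  move=> /stableP sS; apply/card_le1_eqP => x y xS yS; apply/eqP.
  by apply: contraT => xy; move: (sS _ _ yS xS); rewrite c.
have se : [set S : {set G} | #|S| <= 1] = stables G.
  apply/eqP; rewrite eqEcard e leqnn andbT; apply/subsetP => S.
  by rewrite !inE; apply: stable_card_le1.
move=> x y xy; apply: contraT => nxy.
have : [set x; y] \in stables G.
  rewrite inE; apply/stableP => u v; rewrite !inE.
  by case/orP=> /eqP -> /orP[] /eqP ->; rewrite ?adj_irr // adj_sym.
by rewrite -se inE cards2 xy.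
Qed.

End Counting.

(** * Functionals bounded on the stable sets *)

Local Open Scope ring_scope.

Section Facets.
Variables (R : realFieldType) (G : sgraph).

Definition sgn {V : pzRingType} (b : bool) : V := if b then 1 else -1.

(** The affine functional [(al, be)] at the characteristic vector of [S]. *)
Definition functional (al : G -> R) (be : R) (S : {set G}) : R :=
  \sum_(v in S) al v + be.

Lemma colouring_functional al be (w : G -> nat) l : colouring w l ->
  \sum_(S <- l) functional al be S = \sum_v al v *+ w v + be *+ size l.
Proof.
case=> _ cl; rewrite big_split /= big_const_seq count_predT iter_addr_0.
congr (_ + _); under [RHS]eq_bigr do rewrite -cl -sum1_count.
under eq_bigr do rewrite big_mkcond /=.
rewrite exchange_big /=; apply: eq_bigr => v _.
by rewrite -big_mkcond /= -sumrMnr.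
Qed.

(** Suppose that no signed clique constraint is tight at all the [m] signed stable
sets where the functional attains 1, and let [(y, u)] be the sum of their
integer vectors, where the functional takes the value [m].  Every signed clique
constraint takes values in [{-1, 1}] on the summands and misses 1 at
least once, so it is at most [m - 1] on [(y, u)].  The clique bounds then allow
to colour the positive part of [2 * y] with [m - 1 + u] stable sets and its
negative part with [m - 1 - u], and the functional is at most [2 * (m - 1)] on
the resulting expression of [(2 * y, 2 * u)], where its value is [2 * m]: a
contradiction. *)
Lemma facet_clique al be : perfect G ->
  (forall S, stable S -> `|functional al be S| <= 1) ->
  exists b K, clique K /\ forall c S, stable S ->
    sgn c * functional al be S = 1 -> #|S :&: K| = (c == b) :> nat.
Proof.
move=> perfG bnd.
pose f := functional al be.
pose F := [set p : bool * {set G} | stable p.2 & sgn p.1 * f p.2 == 1].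
pose good (q : bool * {set G}) :=
  clique q.2 && [forall p in F, #|p.2 :&: q.2| == (p.1 == q.1)].
have [/existsP[[b K] /andP[/= cK /forall_inP H]]|bad] := boolP [exists q, good
  q].
  exists b, K; split=> // c S sS fS.
  by apply/eqP; apply: (H (c, S)); rewrite inE /= sS fS eqxx.
pose y v : int := \sum_(p in F) sgn p.1 *+ (v \in p.2).
pose u : int := \sum_(p in F) sgn p.1.
pose M : int := #|F|%:Z - 1.
(* tau K p is the value of the constraint of K at the signed set p. *)
pose tau (K : {set G}) (p : bool * {set G}) : int := sgn p.1 * (#|p.2 :&: K|%:Z
  *+ 2 - 1).
have yK (K : {set G}) : (\sum_(v in K) y v) *+ 2 - u = \sum_(p in F) tau K p.
  rewrite exchange_big /= -sumrMnl -sumrB; apply: eq_bigr => p _.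
  rewrite /tau mulrBr mulr1; congr (_ - _); rewrite mulrnAr; congr (_ *+ 2).
  rewrite -sum1_card (big_morph Posz PoszD (erefl _)) mulr_sumr.
  rewrite big_mkcond [RHS]big_mkcond; apply: eq_bigr => v _ /=.
  by rewrite inE andbC; case: (v \in K); case: (v \in p.2);
    rewrite ?mulr1 ?mulr0.

have tau1 (K : {set G}) (p : bool * {set G}) : clique K -> p \in F -> tau K p =
  sgn (#|p.2 :&: K| == p.1).
  move=> cK; rewrite inE => /andP[sS _]; have := stable_clique_meet sS cK.
  by rewrite /tau; case: p.1; case: #|_| => [|[]].
have tauM b (K : {set G}) : clique K -> sgn b * \sum_(p in F) tau K p <= M.
  move=> cK.
  have /forall_inPn[p pF np] : ~~ [forall p in F, #|p.2 :&: K| == (p.1 == b)].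
    by apply: contra bad => H; apply/existsP; exists (b, K);
      rewrite /good /= cK.
  rewrite mulr_sumr (bigD1 p) //= /M (cardD1 p) pF PoszD [1 + _]addrC addrK.
  have -> : sgn b * tau K p = -1.
    move: np; rewrite tau1 //; move: pF; rewrite inE => /andP[sS _].
    have := stable_clique_meet sS cK.
    by case: p.1; case: b; case: #|_| => [|[]].
  have : \sum_(i in F | i != p) sgn b * tau K i <= #|[predD1 F & p]|%:Z.
    rewrite -sum1_card (big_morph Posz PoszD (erefl _)).
    rewrite [X in _ <= X](eq_bigl (fun i => (i \in F) && (i != p))) => [|i];
      last first.
      by rewrite !inE andbC.
    apply: ler_sum => i /andP[iF _]; rewrite tau1 //.
    by case: (b); case: (_ == _).
  by move=> le; rewrite -[X in _ <= X]add0r; apply: lerD le.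

have c0 : clique (set0 : {set G}) by apply: clique_card_le1; rewrite cards0.
(* b = true stands for the positive part of 2y, b = false for the negative one;
   the factor 2 makes the number of classes come out as an integer. *)
pose part (b : bool) v : nat := if 0 <= sgn b * y v then (2 * `|y v|)%N else
  0%N.
pose N (b : bool) : int := M + sgn b * u.
have N0 b : 0 <= N b.
  have := tauM b _ c0; rewrite -yK big_set0 mul0rn sub0r /N.
  by case: (b); rewrite /sgn /= ?mul1r ?mulN1r; lia.
have [l sl cl] : exists2 l : bool -> seq {set G},
    forall b, size (l b) = `|N b|%N & forall b, colouring (part b) (l b).
  have H b : exists2 l : seq {set G}, size l = `|N b|%N & colouring (part b) l.
    apply: perfect_colouring => // K cK.
    pose K' := [set v in K | 0 <= sgn b * y v].
    have cK' : clique K' by apply: clique_sub cK; apply/subsetP => v /setIdP[].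
    have : Posz (\sum_(v in K) part b v)%N = sgn b * (\sum_(v in K') y v) *+ 2.
      rewrite (big_morph Posz PoszD (erefl _)) mulr_sumr -sumrMnl.
      rewrite big_mkcond [RHS]big_mkcond; apply: eq_bigr => v _ /=.
      rewrite inE /part; case: (v \in K) => //=.
      by case: (b); rewrite /sgn; case: ifP => //; lia.
    have := tauM b _ cK'; rewrite -yK; have := N0 b; rewrite /N.
    by case: (b); rewrite /sgn ?mul1r ?mulN1r; lia.
  have [l1 ? ?] := H true; have [l0 ? ?] := H false.
  by exists (fun b => if b then l1 else l0) => -[].
have le b : sgn b * \sum_(S <- l b) f S <= `|N b|%N%:R.
  have [sl' _] := cl b; apply: le_trans (ler_norm _) _.
  rewrite normrM (_ : `|sgn b| = 1) ?mul1r; last by case: (b);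
    rewrite /sgn ?normrN1 ?normr1.
  apply: le_trans (ler_norm_sum _ _ _) _; rewrite -sl -sum1_size natr_sum.
  rewrite big_seq [X in _ <= X]big_seq; apply: ler_sum => S Sl.
  by apply: bnd; move/allP: sl'; apply.
have vy v : al v *+ part true v - al v *+ part false v = al v * (y v)%:~R *+ 2.
  have e : (part true v)%:Z - (part false v)%:Z = y v * 2.
    by rewrite /part /sgn mul1r mulN1r; do 2!case: ifP; lia.
  have e' : (part true v)%:R - (part false v)%:R = (y v)%:~R * 2 :> R.
    by have := congr1 (intr : int -> R) e; rewrite rmorphB rmorphM.
  rewrite -[_ *+ part true v]mulr_natr -[_ *+ part false v]mulr_natr -mulrBr e'.
  by rewrite mulrA mulr_natr.
have fF : \sum_(p in F) sgn p.1 * f p.2 = #|F|%:R.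
  rewrite -sum1_card natr_sum; apply: eq_bigr => p.
  by rewrite inE => /andP[_ /eqP].
have fE : \sum_(p in F) sgn p.1 * f p.2 = \sum_v al v * (y v)%:~R + be * u%:~R.
  rewrite (eq_bigr (fun p : bool * {set G} =>
    \sum_v al v * (sgn p.1 *+ (v \in p.2) : int)%:~R + be * (sgn p.1 :
      int)%:~R)).
    rewrite big_split exchange_big /= -mulr_sumr; congr (_ + be * _).
      by apply: eq_bigr => v _; rewrite -mulr_sumr rmorph_sum.
    by rewrite rmorph_sum.
  move=> p _; have -> : (sgn p.1 : int)%:~R = sgn p.1 :> R by case: p.1.
  rewrite mulrDr [sgn _ * be]mulrC mulr_sumr big_mkcond; congr (_ + _).
  apply: eq_bigr => v _ /=;
    have -> : (sgn p.1 *+ (v \in p.2) : int)%:~R = sgn p.1 *+ (v \in p.2) :> R.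
    by case: p.1; case: (_ \in _).
  by case: (_ \in _); rewrite ?mulr0 // mulrC.
have := lerD (le true) (le false).
rewrite /sgn mul1r mulN1r !(colouring_functional _ _ (cl _)) !sl.
have NR b : (`|N b|%N)%:R = (N b)%:~R :> R by rewrite pmulrn gez0_abs.
rewrite opprD addrACA -sumrB (eq_bigr _ (fun v _ => vy v)) sumrMnl -[(\sum_v _)
  *+ 2]mulr_natr.
rewrite -[be *+ `|N true|%N]mulr_natr -[be *+ `|N false|%N]mulr_natr -mulrBr
  !NR -!rmorphB /=.
rewrite -rmorphD /=.
have -> : N true - N false = u * 2 by rewrite /N /sgn; lia.
have -> : N true + N false = #|F|%:Z * 2 - 2 by rewrite /N /sgn /M; lia.
rewrite rmorphM rmorphB rmorphM /= mulrA -mulrDl -fE fF.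
rewrite -pmulrn; lra.
Qed.
End Facets.

(** * Convex and affine hulls *)

From mathcomp Require Import finmap boolp classical_sets functions cardinality.
From mathcomp Require Import reals.

Local Open Scope classical_set_scope.
Local Open Scope ring_scope.

Lemma card_fset_set_image (I : finType) (T : choiceType) (f : I -> T)
    (A : {set I}) :
  {in A &, injective f} ->
  #|` fset_set [set f i | i in [set i | i \in A]]| = #|A|.
Proof.
move=> fI; have -> : [set i | i \in A] = [set` [fset i in A]%fset].
  by apply/seteqP; split=> i /=; rewrite !inE.
rewrite fset_set_image ?set_fsetK; last exact: finite_fset.
rewrite card_in_imfset /=; last by move=> i j; rewrite !inE; apply: fI.
by rewrite card_imfset //= -cardE.
Qed.

Lemma big_option (W : nmodType) (T : finType) (f : option T -> W) :
  \sum_o f o = \sum_v f (Some v) + f None.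
Proof.
rewrite (bigD1 None) //= addrC; congr (_ + _).
rewrite (reindex_omap Some id) => [|[v|]] //=.
by apply: eq_bigl => v; rewrite eqxx.
Qed.

Section Hulls.
Variables (R : realType) (m : nat).
Implicit Types (A B : set 'rV[R]_m) (a x y z : 'rV[R]_m) (b : R).

Lemma dotpE a x : dotp a x = (x *m a^T) 0 0.
Proof. by rewrite mxE; apply: eq_bigr => i _; rewrite mxE mulrC. Qed.

Lemma dotpDr a x y : dotp a (x + y) = dotp a x + dotp a y.
Proof. by rewrite !dotpE mulmxDl mxE. Qed.

Lemma dotpZr a c x : dotp a (c *: x) = c * dotp a x.
Proof. by rewrite !dotpE -scalemxAl mxE. Qed.

Lemma dotpZl a c x : dotp (c *: a) x = c * dotp a x.
Proof. by rewrite !dotpE linearZ -scalemxAr mxE. Qed.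

Lemma dotpNr a x : dotp a (- x) = - dotp a x.
Proof. by rewrite -scaleN1r dotpZr mulN1r. Qed.

Lemma dotp0r a : dotp a 0 = 0.
Proof. by rewrite dotpE mul0mx mxE. Qed.

Lemma dotp_sumr (I : Type) (r : seq I) (P : pred I) a (c : I -> R)
    (p : I -> 'rV[R]_m) :
  dotp a (\sum_(i <- r | P i) c i *: p i) = \sum_(i <- r | P i) c i * dotp a (p
    i).
Proof.
elim/big_rec2: _ => [|i u v _ <-]; first exact: dotp0r.
by rewrite dotpDr dotpZr.
Qed.

Lemma sum_enum_val (V : nmodType) (I : finType) (f : I -> V) :
  \sum_(i < #|I|) f (enum_val i) = \sum_i f i.
Proof. exact/esym/big_enum_val. Qed.

Lemma conv_hull_fin (I : finType) A (c : I -> R) (p : I -> 'rV[R]_m) :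
  (forall i, A (p i)) -> (forall i, 0 <= c i) -> \sum_i c i = 1 ->
  conv_hull A (\sum_i c i *: p i).
Proof.
move=> pA c0 c1; exists #|I|, (c \o enum_val), (p \o enum_val);
  split=> [i|i||] /=.
- exact: pA.
- exact: c0.
- by rewrite sum_enum_val.
- by rewrite (sum_enum_val (fun i => c i *: p i)).
Qed.

Lemma aff_hull_fin (I : finType) A (c : I -> R) (p : I -> 'rV[R]_m) :
  (forall i, A (p i)) -> \sum_i c i = 1 -> aff_hull A (\sum_i c i *: p i).
Proof.
move=> pA c1; exists #|I|, (c \o enum_val), (p \o enum_val); split=> [i||] /=.
- exact: pA.
- by rewrite sum_enum_val.
- by rewrite (sum_enum_val (fun i => c i *: p i)).
Qed.

Lemma sub_conv_hull A : A `<=` conv_hull A.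
Proof.
move=> x Ax; have := @conv_hull_fin unit A (fun=> 1) (fun=> x).
by rewrite !big_const !card_unit /= !addr0 scale1r; apply.
Qed.

Lemma sub_aff_hull A : A `<=` aff_hull A.
Proof.
move=> x Ax; have := @aff_hull_fin unit A (fun=> 1) (fun=> x).
by rewrite !big_const !card_unit /= !addr0 scale1r; apply.
Qed.

Lemma conv_hull_idem A : conv_hull (conv_hull A) `<=` conv_hull A.
Proof.
move=> x [n [c [p [pA c0 c1 ->]]]].
have H i : { k : nat & {q : ('I_k -> R) * ('I_k -> 'rV[R]_m) |
    [/\ forall j, A (q.2 j), forall j, 0 <= q.1 j, \sum_j q.1 j = 1
      & p i = \sum_j q.1 j *: q.2 j]}}.
  have /cid[k /cid[d /cid[q Q]]] := pA i.
  by exists k, (d, q).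
pose k i := projT1 (H i); pose d i := (sval (projT2 (H i))).1.
pose q i := (sval (projT2 (H i))).2.
have Q i : [/\ forall j, A (q i j), forall j, 0 <= d i j, \sum_j d i j = 1
      & p i = \sum_j d i j *: q i j] := svalP (projT2 (H i)).
have -> : \sum_i c i *: p i = \sum_(t : {i : 'I_n & 'I_(k i)})
    (c (tag t) * d (tag t) (tagged t)) *: q (tag t) (tagged t).
  rewrite (eq_bigr (fun i => \sum_(j : 'I_(k i)) (c i * d i j) *: q i j)).
    by rewrite sig_big_dep.
  move=> i _; have [_ _ _ ->] := Q i.
  by rewrite scaler_sumr; apply: eq_bigr => j _; rewrite scalerA.
apply: conv_hull_fin => [t|t|].
- by have [] := Q (tag t).
- by rewrite mulr_ge0 ?c0 //; have [] := Q (tag t).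
rewrite -(sig_big_dep xpredT (fun=> xpredT) (fun i (j : 'I_(k i)) => c i * d i
  j)) /=.
rewrite -[RHS]c1; apply: eq_bigr => i _.
by rewrite -mulr_sumr; have [_ _ -> _] := Q i; rewrite mulr1.
Qed.

Lemma conv_hullS A B : A `<=` B -> conv_hull A `<=` conv_hull B.
Proof.
by move=> AB x [n [c [p [pA c0 c1 ->]]]]; apply: conv_hull_fin => // i;
  apply: AB.
Qed.

Lemma conv_hull_comb (I : finType) A (c : I -> R) (p : I -> 'rV[R]_m) :
  (forall i, conv_hull A (p i)) -> (forall i, 0 <= c i) -> \sum_i c i = 1 ->
  conv_hull A (\sum_i c i *: p i).
Proof. by move=> *; apply: conv_hull_idem; apply: conv_hull_fin. Qed.

Lemma conv_hull_mid A x y z :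
  conv_hull A x -> conv_hull A y -> z + z = x + y -> conv_hull A z.
Proof.
move=> Ax Ay e.
have -> : z = \sum_(b : bool) 2^-1 *: (if b then x else y).
  rewrite big_bool /= -scalerDr -e -mulr2n -scaler_nat scalerA mulVf ?scale1r
    //.
  by rewrite pnatr_eq0.
apply: conv_hull_comb => [[]|_|] //; first by rewrite invr_ge0 ler0n.
by rewrite sumr_const card_bool mulr2n; lra.
Qed.

Lemma conv_hull_le A a b :
  (forall x, A x -> dotp a x <= b) -> forall x, conv_hull A x -> dotp a x <= b.
Proof.
move=> Ab x [n [c [p [pA c0 c1 ->]]]]; rewrite dotp_sumr.
rewrite -[leRHS]mul1r -c1 mulr_suml; apply: ler_sum => i _.
by rewrite ler_wpM2l ?c0 // Ab.
Qed.

Lemma sum1_neq0 n (c : 'I_n -> R) : \sum_i c i = 1 -> exists i, c i != 0.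
Proof.
move=> c1; apply/existsP; apply: contraT; rewrite negb_exists => /forallP H.
move: c1; rewrite big1 => [/esym/eqP|i _]; first by rewrite oner_eq0.
by have := H i; rewrite negbK => /eqP.
Qed.

(** A convex combination attains the maximum of a functional only if all its
points of nonzero weight do; the others are replaced by one of these. *)
Lemma conv_hull_face A a b : (forall x, A x -> dotp a x <= b) ->
  forall x, conv_hull A x -> dotp a x = b ->
  conv_hull (A `&` [set x | dotp a x = b]) x.
Proof.
move=> Ab x [n [c [p [pA c0 c1 xE]]]]; rewrite {1}xE dotp_sumr => e.
have tight i : c i != 0 -> dotp a (p i) = b.
  have : \sum_i c i * (b - dotp a (p i)) = 0.
    under eq_bigr do rewrite mulrBr.
    by rewrite sumrB -mulr_suml c1 mul1r e subrr.
  move/eqP; rewrite psumr_eq0 => [/allP/(_ i)|j _]; last first.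
    by rewrite mulr_ge0 ?subr_ge0 ?Ab.
  rewrite mem_index_enum => /(_ isT); rewrite mulf_eq0.
  by case/orP=> /eqP; [move->; rewrite eqxx|move/subr0_eq].
have [i0 ci0] := sum1_neq0 c1.
have -> : x = \sum_i c i *: (if c i == 0 then p i0 else p i).
  by rewrite xE; apply: eq_bigr => i _; case: eqP => // ->; rewrite !scale0r.
apply: conv_hull_fin => // i; case: ifPn => ci; split=> //=; exact: tight.
Qed.

Lemma conv_hull1 x y : conv_hull [set x] y -> y = x.
Proof.
case=> n [c [p [pA _ c1 ->]]].
rewrite (eq_bigr (fun i => c i *: x)) => [|i _]; last by rewrite (pA i).
by rewrite -scaler_suml c1 scale1r.
Qed.

Lemma aff_hull_eq A a b :
  (forall x, A x -> dotp a x = b) -> forall x, aff_hull A x -> dotp a x = b.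
Proof.
move=> Ab x [n [c [p [pA c1 ->]]]]; rewrite dotp_sumr.
by rewrite -[RHS]mul1r -c1 mulr_suml; apply: eq_bigr => i _; rewrite Ab.
Qed.

Lemma aff_hull1 x : aff_hull [set x] = [set x].
Proof.
apply/seteqP; split=> [y|]; last exact: sub_aff_hull.
case=> n [c [p [pA c1 ->]]].
rewrite (eq_bigr (fun i => c i *: x)) => [|i _]; last by rewrite (pA i).
by rewrite -scaler_suml c1 scale1r.
Qed.

Lemma aff_hull_neq0 A x : aff_hull A x -> exists y, A y.
Proof.
by case=> n [c [p [pA c1 _]]]; have [i _] := sum1_neq0 c1; exists (p i).
Qed.

Definition dotp_hom a : 'Hom('rV[R]_m, 'rV[R]_1) := linfun (mulmxr a^T).

Definition lin_hyperplane a := lker (dotp_hom a).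

Lemma mem_lin_hyperplane a x : (x \in lin_hyperplane a) = (dotp a x == 0).
Proof.
rewrite memv_ker lfunE /= dotpE; apply/eqP/eqP => [->|e]; first by rewrite mxE.
by apply/rowP => i; rewrite [i]ord1 [RHS]mxE.
Qed.

Lemma dim_lin_hyperplane a x : dotp a x != 0 -> \dim (lin_hyperplane a) = m.-1.
Proof.
move=> ax; have := limg_ker_dim (dotp_hom a) fullv.
rewrite capfv dimvf /dim /= mul1n => e.
suff d1 : \dim (dotp_hom a @: fullv)%VS = 1%N by move/(congr1 predn): e;
  rewrite d1 addn1.
apply/eqP; rewrite eqn_leq; apply/andP; split.
  by apply: leq_trans (dimvS (subvf _)) _; rewrite dimvf.
rewrite lt0n dimv_eq0; apply: contra ax => /eqP l0.
have : dotp_hom a x \in (0 : {vspace 'rV[R]_1})%VS.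
  by rewrite -l0 memv_img ?memvf.
by rewrite memv0 lfunE /= dotpE => /eqP ->; rewrite mxE.
Qed.

Lemma has_dim_hyperplane A a x : dotp a x = 1 ->
  aff_hull A = [set y | dotp a y = 1] -> has_dim A m.-1.
Proof.
move=> ax1 AE; exists x, (lin_hyperplane a); split; last first.
  by apply: (@dim_lin_hyperplane _ x); rewrite ax1 oner_eq0.
rewrite AE; apply/seteqP; split=> y /=.
  move=> ay; exists (y - x); last by rewrite addrC subrK.
  by rewrite /= mem_lin_hyperplane dotpDr dotpNr ay ax1 subrr.
case=> v; rewrite /= mem_lin_hyperplane => /eqP av <-.
by rewrite dotpDr av addr0.
Qed.

(** The direction [L] of the affine hull of [A] lies in the kernel of [a] and
has the dimension of that kernel, so [L] is the kernel.  Both functionals vanish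
on [L] and are 1 at a point off [L]. *)
Lemma hyperplane_unique A a a' : has_dim A m.-1 ->
  (forall x, A x -> dotp a x = 1) -> (forall x, A x -> dotp a' x = 1) ->
  forall x, dotp a x = dotp a' x.
Proof.
case=> x0 [L [AL dL]] a1 a'1.
have on_hull a2 v : (forall x, A x -> dotp a2 x = 1) -> v \in L -> dotp a2 (x0
  + v) = 1.
  by move=> a21 vL; apply: (aff_hull_eq a21); rewrite AL; exists v.
have x01 a2 : (forall x, A x -> dotp a2 x = 1) -> dotp a2 x0 = 1.
  by move=> a21; rewrite -[x0]addr0 on_hull ?mem0v.
have on_L a2 v : (forall x, A x -> dotp a2 x = 1) -> v \in L -> dotp a2 v = 0.
  by move=> a21 vL; have := on_hull _ _ a21 vL; rewrite dotpDr x01 //; lra.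
have LE : L = lin_hyperplane a.
  apply/eqP; rewrite eqEdim dL (@dim_lin_hyperplane _ x0) ?x01 ?oner_eq0 //
    leqnn andbT.
  by apply/subvP => v vL; rewrite mem_lin_hyperplane on_L.
move=> x; have : x - dotp a x *: x0 \in L.
  by rewrite LE mem_lin_hyperplane dotpDr dotpNr dotpZr x01 // mulr1 subrr.
by move/(on_L a' _ a'1);
  rewrite dotpDr dotpNr dotpZr x01 // mulr1 => /subr0_eq ->.
Qed.

Lemma has_dim_full A : (forall x, aff_hull A x) -> forall k, has_dim A k <-> k
  = m.
Proof.
move=> AT k; split=> [[x [L [AL <-]]]|->].
  have -> : L = fullv.
    apply/vspaceP => v; rewrite memvf.
    by have := AT (x + v); rewrite AL => -[w /= wL] /addrI <-.
  by rewrite dimvf /dim /= mul1n.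
exists 0, fullv; split; last by rewrite dimvf /dim /= mul1n.
by apply/seteqP; split=> v //= _; exists v; rewrite ?memvf ?add0r.
Qed.

Lemma has_dim0 A : has_dim A 0 <-> exists x, A = [set x].
Proof.
split=> [[x [L [AL /eqP]]]|[x ->]].
  rewrite dimv_eq0 => /eqP L0; exists x.
  have AE : aff_hull A = [set x].
    rewrite AL L0; apply/seteqP; split=> y /=.
      by case=> v; rewrite /= memv0 => /eqP -> <-; rewrite addr0.
    by move->; exists 0; rewrite /= ?mem0v ?addr0.
  have Ax y : A y -> y = x by move/sub_aff_hull; rewrite AE.
  have [y Ay] : exists y, A y by apply: (@aff_hull_neq0 _ x); rewrite AE.
  by apply/seteqP; split=> [z /Ax|z ->] //; rewrite -(Ax y).
exists x, 0%VS; split; last by rewrite dimv0.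
rewrite aff_hull1; apply/seteqP; split=> y /=.
  by move->; exists 0; rewrite /= ?mem0v ?addr0.
by case=> v; rewrite /= memv0 => /eqP -> <-; rewrite addr0.
Qed.

(** The midpoint condition is written without division. *)
Definition extreme A : set 'rV[R]_m :=
  [set x | A x /\ forall y z, A y -> A z -> x + x = y + z -> y = x].

(** If [p] has weight [e > 0] in a convex combination [x], then moving [x] by
[e *: (p - x)] in either direction stays in the hull, so an extreme [x] is
[p]. *)
Lemma extreme_conv_hull A : extreme (conv_hull A) `<=` A.
Proof.
move=> x [[n [c [p [pA c0 c1 xE]]]] xext].
have [i0 ci0] := sum1_neq0 c1.
have hull d : (forall i, 0 <= d i) -> \sum_i d i = 1 -> conv_hull A (\sum_i d i
  *: p i).
  by move=> *; apply: conv_hull_fin.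
pose e := c i0.
have e1 : e <= 1 by rewrite -c1 (bigD1 i0) //= lerDl sumr_ge0.
have e0 : 0 <= e by apply: c0.
have delta (V : lmodType R) (f : 'I_n -> V) : \sum_i (i == i0)%:R *: f i = f i0.
  by rewrite (bigD1 i0) //= eqxx scale1r big1 ?addr0 // => i /negPf ->;
    rewrite scale0r.
have delta1 : \sum_i (i == i0)%:R = 1 :> R.
  by rewrite (bigD1 i0) //= eqxx big1 ?addr0 // => i /negPf ->.
have yA : conv_hull A (x + e *: (p i0 - x)).
  have -> : x + e *: (p i0 - x) = \sum_i ((1 - e) * c i + e * (i == i0)%:R) *:
    p i.
    under eq_bigr do rewrite scalerDl -!scalerA.
    rewrite big_split -!scaler_sumr -xE /= delta scalerBr scalerBl scale1r.
    by rewrite addrCA addrC.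
  apply: hull => [i|]; first by rewrite addr_ge0 ?mulr_ge0 ?subr_ge0.
  by rewrite big_split -!mulr_sumr /= c1 delta1; ring.
have zA : conv_hull A (x - e *: (p i0 - x)).
  have -> : x - e *: (p i0 - x) = \sum_i ((1 + e) * c i - e * (i == i0)%:R) *:
    p i.
    under eq_bigr do rewrite scalerBl -!scalerA.
    rewrite sumrB -!scaler_sumr -xE /= delta scalerBr scalerDl scale1r.
    by rewrite opprB addrA.
  apply: hull => [i|]; last by rewrite sumrB -!mulr_sumr /= c1 delta1; ring.
  have [->|] := eqVneq; last by rewrite mulr0 subr0 mulr_ge0 ?addr_ge0.
  by rewrite -/e mulrDl mul1r mulr1 addrC addKr mulr_ge0.
have mid : x + x = (x + e *: (p i0 - x)) + (x - e *: (p i0 - x)).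
  by rewrite addrACA subrr addr0.
have /eqP := xext _ _ yA zA mid;
  rewrite -subr_eq0 addrC addKr scaler_eq0 (negPf ci0) subr_eq0 => /eqP <-.
exact: pA.
Qed.
End Hulls.

(** Extreme points are an affine invariant; convexity of the source is what
allows to pull a midpoint back, as the map is injective on the source only. *)
Lemma extreme_aff_bij (R : realType) (m k : nat) (A : set 'rV[R]_m)
    (Q : set 'rV[R]_k) (M : 'M[R]_(m, k)) (b : 'rV[R]_k) :
  set_bij (conv_hull A) Q (fun x => x *m M + b) ->
  extreme Q = [set x *m M + b | x in extreme (conv_hull A)].
Proof.
set f := fun x => _; case=> fQ fI fS.
have fP x : conv_hull A x -> Q (f x) by move=> xA; apply: fQ.
have fD x y z : f x + f x = f y + f z <-> (x + x) *m M = (y + z) *m M.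
  have E u v : f u + f v = (u + v) *m M + (b + b) by rewrite /f addrACA
    -mulmxDl.
  by rewrite !E; split=> [/addIr|->].
apply/seteqP; split=> [_ [/fS[x xA <-] xext]|_ [x [xA xext] <-]].
  exists x => //; split=> // y z yA zA e.
  have fe : f x + f x = f y + f z by apply/fD; rewrite e.
  by apply: fI; rewrite ?inE //; apply: xext fe; apply: fP.
split; first exact: fP.
move=> _ _ /fS[y yA <-] /fS[z zA <-] /fD e; congr f; apply: (xext y z) => //.
pose w := 2^-1 *: (y + z); have ww : w + w = y + z.
  by rewrite -scalerDl (_ : 2^-1 + 2^-1 = 1) ?scale1r //; field.
rewrite -ww; suff -> : x = w by [].
have wA : conv_hull A w by apply: conv_hull_mid yA zA ww.
apply: fI; rewrite ?inE //; congr (_ + _).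
move: e; rewrite -ww !mulmxDl -!mulr2n -!scaler_nat.
by apply: scalerI; rewrite pnatr_eq0.
Qed.

(** * Vertices and facets of the Hansen polytope *)

Section HansenPolytope.
Variables (R : realType) (G : sgraph).
Notation V := 'rV[R]_(#|vert G| + 1).
Implicit Types (x y a : V) (v : G) (be : R).

(** Reading the coordinates at the vertices of [G] themselves, and the last one as
a height, keeps the enumeration of the vertices out of what follows. *)
Definition vcoord x v : R := x 0 (lshift 1 (enum_rank v)).
Definition hcoord x : R := x 0 (rshift #|vert G| ord0).
Definition pt (al : G -> R) be : V :=
  row_mx (\row_i al (enum_val i)) (const_mx be).

Lemma vcoord_row (u : 'rV[R]_#|vert G|) (t : 'rV[R]_1) v :
  vcoord (row_mx u t) v = u 0 (enum_rank v).
Proof. by rewrite /vcoord row_mxEl. Qed.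

Lemma hcoord_row (u : 'rV[R]_#|vert G|) (t : 'rV[R]_1) :
  hcoord (row_mx u t) = t 0 0.
Proof. by rewrite /hcoord row_mxEr. Qed.

Lemma vcoord_pt al be v : vcoord (pt al be) v = al v.
Proof. by rewrite vcoord_row mxE enum_rankK. Qed.

Lemma hcoord_pt al be : hcoord (pt al be) = be.
Proof. by rewrite hcoord_row mxE. Qed.

Lemma pt_eq x y : vcoord x =1 vcoord y -> hcoord x = hcoord y -> x = y.
Proof.
move=> xy_v xy_h; apply/rowP => i.
have [j|j] := split_ordP i => ->; last by rewrite [j]ord1; apply: xy_h.
by rewrite -[j]enum_valK; apply: xy_v.
Qed.

Lemma vcoordD x y v : vcoord (x + y) v = vcoord x v + vcoord y v.
Proof. by rewrite /vcoord mxE. Qed.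

Lemma hcoordD x y : hcoord (x + y) = hcoord x + hcoord y.
Proof. by rewrite /hcoord mxE. Qed.

Lemma vcoord0 v : vcoord 0 v = 0. Proof. by rewrite /vcoord mxE. Qed.
Lemma hcoord0 : hcoord 0 = 0. Proof. by rewrite /hcoord mxE. Qed.

Lemma vcoord_sum (I : finType) (c : I -> R) (p : I -> V) v :
  vcoord (\sum_i c i *: p i) v = \sum_i c i * vcoord (p i) v.
Proof. by rewrite /vcoord summxE; apply: eq_bigr => i _; rewrite mxE. Qed.

Lemma hcoord_sum (I : finType) (c : I -> R) (p : I -> V) :
  hcoord (\sum_i c i *: p i) = \sum_i c i * hcoord (p i).
Proof. by rewrite /hcoord summxE; apply: eq_bigr => i _; rewrite mxE. Qed.

Lemma sum_coord (W : nmodType) (f : 'I_(#|vert G| + 1) -> W) :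
  \sum_i f i =
    \sum_v f (lshift 1 (enum_rank v)) + f (rshift #|vert G| ord0).
Proof.
rewrite big_split_ord big_ord1; congr (_ + _).
rewrite -(sum_enum_val (fun v => f (lshift 1 (enum_rank v)))).
by apply: eq_bigr => i _; rewrite enum_valK.
Qed.

Lemma dotp_coord a x :
  dotp a x = \sum_v vcoord a v * vcoord x v + hcoord a * hcoord x.
Proof. exact: sum_coord. Qed.

(** The characteristic vector of [p.2] in the top copy of STAB, or its antipode
in the bottom copy when [p.1] is false. *)
Definition gen (p : bool * {set G}) : V :=
  pt (fun v => sgn p.1 * (v \in p.2)%:R) (sgn p.1).

Lemma dotp_gen a p :
  dotp a (gen p) = sgn p.1 * functional (vcoord a) (hcoord a) p.2.
Proof.
rewrite dotp_coord /functional mulrDr hcoord_pt [hcoord a * _]mulrC;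
  congr (_ + _).
rewrite mulr_sumr [RHS]big_mkcond; apply: eq_bigr => v _; rewrite vcoord_pt.
by case: (v \in _); rewrite ?mulr1 ?mulr0 // mulrC.
Qed.

Lemma genN b S : gen (~~ b, S) = - gen (b, S).
Proof.
apply: pt_eq => [v|].
  rewrite vcoord_pt /vcoord [RHS]mxE -/(vcoord (gen (b, S)) v) vcoord_pt.
  by case: b; rewrite /sgn /=; ring.
rewrite hcoord_pt /hcoord [RHS]mxE -/(hcoord (gen (b, S))) hcoord_pt.
by case: b; rewrite /sgn /= ?opprK.
Qed.

Lemma sgn_neq0 b : sgn b != 0 :> R.
Proof. by case: b; rewrite ?oppr_eq0 oner_eq0. Qed.

Lemma sgn_inj : injective (@sgn R).
Proof.
suff H : (1 : R) <> -1 by case=> [] [] //= e; case: H.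
by move/eqP; rewrite -subr_eq0 opprK -mulr2n pnatr_eq0.
Qed.

Lemma gen_inj : injective gen.
Proof.
move=> [b S] [c T] e.
have bc : b = c by have := congr1 hcoord e; rewrite !hcoord_pt => /sgn_inj.
congr pair => //; apply/setP => v; have := congr1 (fun x => vcoord x v) e.
rewrite !vcoord_pt bc /= => /(mulfI (sgn_neq0 c)) /eqP.
by rewrite eqr_nat; case: (v \in S); case: (v \in T).
Qed.

Definition vertices : set V :=
  [set gen p | p in [set p : bool * {set G} | stable p.2]].

Lemma HansE : Hans R G = conv_hull vertices.
Proof.
apply/seteqP; split=> x; last first.
  apply: conv_hullS => _ [[b S] /= sS <-].
  have SS : STAB R G (char_vec R S) by apply: sub_conv_hull; exists S.
  case: b; [left|right]; exists (char_vec R S) => //; apply: pt_eq => [v|];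
  rewrite ?vcoord_row ?hcoord_row !mxE ?enum_rankK /sgn ?mul1r ?mulN1r //.
move=> Px; apply: conv_hull_idem; apply: conv_hullS Px => {x} x.
have H b (y : 'rV[R]_#|vert G|) : STAB R G y ->
    conv_hull vertices (row_mx (sgn b *: y) (const_mx (sgn b))).
  case=> n [c [p [/= pA c0 c1 ->]]].
  have -> : row_mx (sgn b *: \sum_i c i *: p i) (const_mx (sgn b)) =
      \sum_i c i *: row_mx (sgn b *: p i) (const_mx (sgn b)) :> V.
    apply: pt_eq => [v|].
      rewrite vcoord_sum vcoord_row mxE summxE mulr_sumr; apply: eq_bigr => i _.
      by rewrite vcoord_row !mxE mulrCA.
    rewrite hcoord_sum hcoord_row mxE.
    by under eq_bigr do rewrite hcoord_row mxE; rewrite -mulr_suml c1 mul1r.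
  apply: conv_hull_fin => // i; have [S sS <-] := pA i.
  exists (b, S) => //; apply: pt_eq => [v|].
    by rewrite vcoord_pt vcoord_row !mxE enum_rankK.
  by rewrite hcoord_pt hcoord_row mxE.
case=> [[y /(H true) + <-]|[y /(H false) + <-]] //=;
  rewrite /sgn ?scale1r ?scaleN1r //.
Qed.

(** The points of the empty set and of the singletons form a basis of the space,
whatever the signs given to them; [simplex_coord] gives the coordinates for
positive signs. *)
Definition simplex_set (o : option G) : {set G} :=
  if o is Some v then [set v]%SET else finset.set0.

Definition simplex_coord x (o : option G) : R :=
  if o is Some v then vcoord x v else hcoord x - \sum_v vcoord x v.

Lemma stable_simplex o : stable (simplex_set o).
Proof. by apply: stable_card_le1; case: o => [v|]; rewrite ?cards1 ?cards0. Qed.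

Lemma sgn2 b : sgn b * sgn b = 1 :> R.
Proof. by case: b; rewrite /sgn ?mulr1 ?mulrNN ?mulr1. Qed.

Lemma simplex_expand (s : option G -> bool) x :
  x = \sum_o (sgn (s o) * simplex_coord x o) *: gen (s o, simplex_set o).
Proof.
apply: pt_eq => [v|].
  rewrite vcoord_sum big_option (bigD1 v) //= big1 => [|u uv].
    by rewrite !vcoord_pt /= !inE eqxx !mulr1 mulr0 mulr0 !addr0 mulrAC sgn2
      mul1r.
  by rewrite vcoord_pt /= inE eq_sym (negPf uv) !mulr0.
rewrite hcoord_sum big_option /= hcoord_pt /=.
under eq_bigr do rewrite hcoord_pt /= mulrAC sgn2 mul1r.
by rewrite mulrAC sgn2 mul1r addrC subrK.
Qed.

(** The origin is the midpoint of two antipodal generators, so the affine hull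
is the linear span. *)
Lemma aff_hull_Hans x : aff_hull (Hans R G) x.
Proof.
pose p (o : option (option G)) : V :=
  if o is Some o' then gen (true, simplex_set o') else 0.
pose c (o : option (option G)) : R :=
  if o is Some o' then simplex_coord x o' else 1 - \sum_o simplex_coord x o.
have -> : x = \sum_o c o *: p o.
  rewrite big_option /= scaler0 addr0 {1}[x](simplex_expand (fun=> true)).
  by apply: eq_bigr => o _; rewrite mul1r.
apply: aff_hull_fin => [o|]; last by rewrite big_option /= addrC subrK.
rewrite HansE; have gV b : vertices (gen (b, simplex_set None)).
  by exists (b, simplex_set None) => //; exact: (stable_simplex None).
case: o => [o|] /=.
  by apply: sub_conv_hull; exists (true, simplex_set o) => //;
    exact: stable_simplex.
apply: (conv_hull_mid (sub_conv_hull (gV true)) (sub_conv_hull (gV false))).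
apply: pt_eq => [v|].
  by rewrite addr0 vcoordD vcoord0 !vcoord_pt /= !inE !mulr0 addr0.
by rewrite addr0 hcoordD hcoord0 !hcoord_pt /= addrN.
Qed.

(** For [p = (true, S)] take weight 1 on [S], -1 off [S], and [n + 1] on the
height: at the top copy of [T] the value drops by the size of the symmetric
difference of [S] and [T], which is at most [n], so the value stays positive
and all bottom points have a negative one. *)
Lemma gen_exposed p : exists a be,
  dotp a (gen p) = be /\
  forall q, dotp a (gen q) <= be /\ (dotp a (gen q) = be -> q = p).
Proof.
case: p => b S.
pose n1 : R := #|vert G|.+1%:R.
pose al v : R := (v \in S)%:R *+ 2 - 1.
pose a := sgn b *: pt al n1; exists a, (#|S|%:R + n1).
pose D (T : {set G}) : R := (\sum_v ((v \in S) (+) (v \in T)))%N%:R.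
have fE (T : {set G}) : functional al n1 T = #|S|%:R + n1 - D T.
  rewrite /functional /D addrAC; congr (_ + _).
  rewrite -sum1_card !natr_sum big_mkcond [X in _ = X - _]big_mkcond -sumrB.
  by apply: eq_bigr => v _; rewrite /al; case: (v \in S);
    case: (v \in T) => /=; ring.
have aE c T : dotp a (gen (c, T)) = sgn b * sgn c * (#|S|%:R + n1 - D T).
  rewrite dotpZl dotp_gen mulrA; congr (_ * _);
    rewrite -fE /functional hcoord_pt.
  by congr (_ + _); apply: eq_bigr => v _; rewrite vcoord_pt.
have DS : D S = 0 by rewrite /D big1 // => v _; rewrite addbb.
have D0 T : 0 <= D T by apply: ler0n.
have Dn (T : {set G}) : D T < n1.
  rewrite ltr_nat ltnS -sum1_card; apply: leq_sum => v _; by case: (_ (+) _).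
have S0 : 0 <= #|S|%:R :> R by apply: ler0n.
rewrite aE sgn2 mul1r DS subr0; split=> // -[c T]; rewrite aE.
have [<-|bc] := eqVneq b c.
  rewrite sgn2 mul1r; split=> [|e]; first by rewrite gerBl.
  congr pair; apply/setP => v; have : D T == 0.
    by move/eqP: e; rewrite -subr_eq0 addrAC subrr add0r oppr_eq0.
  rewrite /D pnatr_eq0 sum_nat_eq0 => /forallP /(_ v) /=.
  by case: (v \in S); case: (v \in T).
have -> : sgn b * sgn c = -1 :> R.
  by case: b c bc {a aE} => [] [] //; rewrite /sgn ?mulr1 ?mul1r.
have := Dn T; have := D0 T; split=> [|e]; [lra|exfalso; lra].
Qed.

Lemma extreme_Hans : extreme (Hans R G) = vertices.
Proof.
rewrite HansE; apply/seteqP; split=> [|_ [p /= sp <-]];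
  first exact: extreme_conv_hull.
have gp : vertices (gen p) by exists p.
split=> [|y z yP zP e]; first exact: sub_conv_hull.
have [a [be [ap aq]]] := gen_exposed p.
have le w : vertices w -> dotp a w <= be by case=> q _ <-; case: (aq q).
have := conv_hull_le le yP; have := conv_hull_le le zP.
have := congr1 (dotp a) e; rewrite !dotpDr ap => ? ? ?.
have ya : dotp a y = be by lra.
apply: conv_hull1; apply: conv_hullS (conv_hull_face le yP ya).
by move=> _ [[q _ <-] /= /(proj2 (aq q)) ->].
Qed.

Lemma card_signed_stables :
  #|[set p : bool * {set G} | stable p.2]%SET| = (2 * #|stables G|)%N.
Proof.
rewrite -[2%N]card_bool -cardsT -cardsX; apply: eq_card => p.
by rewrite !inE.
Qed.

Lemma card_signed_cliques :
  #|[set p : bool * {set G} | clique p.2]%SET| = (2 * #|cliques G|)%N.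
Proof.
rewrite -[2%N]card_bool -cardsT -cardsX; apply: eq_card => p.
by rewrite !inE.
Qed.

Lemma vertex_faces :
  [set F | face (Hans R G) F /\ has_dim F 0] =
  [set [set gen p] | p in [set p | p \in [set p : bool * {set G} | stable
    p.2]%SET]].
Proof.
apply/seteqP; split=> F /=.
  case=> -[a [b [ab FE]]] /has_dim0[x Fx].
  have [xP ax] : (Hans R G `&` [set x | dotp a x = b]) x by rewrite -FE Fx.
  have le w : vertices w -> dotp a w <= b.
    by move=> wV; apply: ab; rewrite HansE; apply: sub_conv_hull.
  rewrite HansE in xP.
  have [n [c [p [pA _ c1 _]]]] := conv_hull_face le xP ax.
  have [i _] := sum1_neq0 c1; have [[q sq qp] /= aq] := pA i.
  exists q; first by rewrite inE.
  have : F (p i) by rewrite FE; split=> //; rewrite HansE;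
    apply: sub_conv_hull; exists q.
  by rewrite Fx qp => ->.
case=> p; rewrite inE => sp <-; split; last by apply/has_dim0; exists (gen p).
have [a [be [ap aq]]] := gen_exposed p; exists a, be.
have le w : vertices w -> dotp a w <= be by case=> q _ <-; case: (aq q).
split=> [x|]; first by rewrite HansE; apply: conv_hull_le.
apply/seteqP; split=> x /=.
  by move->; split=> //; rewrite HansE; apply: sub_conv_hull; exists p.
case; rewrite HansE => xP xa.
apply: conv_hull1; apply: conv_hullS (conv_hull_face le xP xa).
by move=> _ [[q _ <-] /= /(proj2 (aq q)) ->].
Qed.

Lemma face_number0 : face_number (Hans R G) 0 = (2 * #|stables G|)%N.
Proof.
rewrite /face_number vertex_faces card_fset_set_image ?card_signed_stables //.
move=> p q _ _ e; apply: gen_inj.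
by have : [set gen q] (gen p) by rewrite -e.
Qed.

(** The constraint [2 x(K) - t <= 1], with the sign [q.1]. *)
Definition clique_functional (q : bool * {set G}) : V :=
  pt (fun v => sgn q.1 * (v \in q.2)%:R *+ 2) (- sgn q.1).

Lemma clique_functional_gen q p : stable p.2 -> clique q.2 ->
  dotp (clique_functional q) (gen p) =
    sgn (#|p.2 :&: q.2| == (p.1 == q.1) :> nat).
Proof.
move=> sp cq; rewrite dotp_gen /functional hcoord_pt.
have -> : \sum_(v in p.2) vcoord (clique_functional q) v = sgn q.1 * #|p.2 :&:
  q.2|%:R *+ 2.
  rewrite -sum1_card natr_sum mulr_sumr -sumrMnl big_mkcond [RHS]big_mkcond.
  apply: eq_bigr => v _ /=; rewrite vcoord_pt inE.
  by case: (v \in p.2); case: (v \in q.2) => /=; rewrite ?mulr0 ?mul0rn.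
have := stable_clique_meet sp cq.
by case: p.1; case: q.1; case: #|_| => [|[]] //= _; rewrite /sgn /=; ring.
Qed.

Definition facet q : set V :=
  Hans R G `&` [set x | dotp (clique_functional q) x = 1].

Lemma gen_facet q p : stable p.2 -> clique q.2 ->
  facet q (gen p) <-> #|p.2 :&: q.2| = (p.1 == q.1).
Proof.
move=> sp cq; split=> [[_ /=]|e].
  by rewrite clique_functional_gen // -[RHS]/(sgn true) => /sgn_inj /eqP.
split; first by rewrite HansE; apply: sub_conv_hull; exists p.
by rewrite /= clique_functional_gen // e eqxx.
Qed.

Lemma clique_functional_le q x : clique q.2 -> Hans R G x ->
  dotp (clique_functional q) x <= 1.
Proof.
move=> cq; rewrite HansE; apply: conv_hull_le => _ [p /= sp <-].
by rewrite clique_functional_gen //; case: (_ == _); rewrite /sgn //; lra.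
Qed.

Lemma facet_face q : clique q.2 -> face (Hans R G) (facet q).
Proof.
move=> cq; exists (clique_functional q), 1; split=> // x.
exact: clique_functional_le.
Qed.

(** The signs that put the basis of [simplex_set] on the facet [q]. *)
Definition facet_sign (q : bool * {set G}) (o : option G) : bool :=
  if o is Some v then (v \in q.2) == q.1 else ~~ q.1.

Lemma facet_simplex q o : clique q.2 ->
  facet q (gen (facet_sign q o, simplex_set o)).
Proof.
move=> cq; apply/gen_facet => //=; first exact: stable_simplex.
case: o => [v|] /=; last by rewrite finset.set0I cards0; case: q.1.
have -> : ([set v] :&: q.2)%SET = if v \in q.2 then [set v]%SET else
  finset.set0.
  by apply/setP => u; rewrite !inE; case: ifP => vq; rewrite !inE;
    case: eqP => [->|].
by case: ifP; rewrite ?cards1 ?cards0; case: q.1.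
Qed.

Lemma clique_functional_simplex q x :
  dotp (clique_functional q) x =
  \sum_o sgn (facet_sign q o) * simplex_coord x o.
Proof.
rewrite dotp_coord big_option /= hcoord_pt mulrBr mulr_sumr addrCA [RHS]addrC.
rewrite -sumrB /=; congr (_ + _); last by case: q.1; rewrite /sgn //= ?opprK.
apply: eq_bigr => v _; rewrite vcoord_pt.
by case: q.1; case: (v \in q.2); rewrite /sgn /=; ring.
Qed.

(** In the basis of generators lying on the facet, the constraint is the sum of
the coordinates, so it equals 1 exactly on affine combinations of the basis. *)
Lemma aff_hull_facet q : clique q.2 ->
  aff_hull (facet q) = [set x | dotp (clique_functional q) x = 1].
Proof.
move=> cq; apply/seteqP; split=> x /=; first by apply: aff_hull_eq => y [].
rewrite clique_functional_simplex {2}[x](simplex_expand (facet_sign q)) => x1.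
by apply: aff_hull_fin => // o; apply: facet_simplex.
Qed.

Lemma has_dim_facet q : clique q.2 -> has_dim (facet q) #|vert G|.
Proof.
move=> cq; have [_ /= e] := facet_simplex None cq.
by have := has_dim_hyperplane e (aff_hull_facet cq);
  rewrite [in X in has_dim _ X]addn1.
Qed.

(** The generators of the empty set and of the singletons that a facet contains
determine its sign and its clique. *)
Lemma facet_inj :
  {in [set q : bool * {set G} | clique q.2]%SET &, injective facet}.
Proof.
move=> [b K] [c L]; rewrite !inE /= => cK cL e.
have E p : stable p.2 -> (#|p.2 :&: K| = (p.1 == b)) <-> (#|p.2 :&: L| = (p.1
  == c)).
  move=> sp; rewrite -(@gen_facet (b, K) p) // -(@gen_facet (c, L) p) // e.
  by [].
have bc : b = c.
  have := E (~~ b, simplex_set None) (stable_simplex None).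
  by rewrite /= !finset.set0I cards0; case: (b) (c) => [] [] //= [] /(_ erefl).
subst c; congr pair; apply/setP => v.
have := E ((v \in K) == b, simplex_set (Some v)) (stable_simplex (Some v)).
have cv (M : {set G}) : #|[set v]%SET :&: M| = (v \in M).
  have -> : ([set v] :&: M)%SET = if v \in M then [set v]%SET else finset.set0.
    by apply/setP => u; rewrite !inE; case: ifP => vq; rewrite !inE;
      case: eqP => [->|].
  by case: ifP; rewrite ?cards1 ?cards0.
rewrite /= !cv; case: b {e E cK cL}; case: (v \in K); case: (v \in L) => //=;
by case=> /(_ erefl).
Qed.

Hypothesis perfG : perfect G.

(** Central symmetry makes the right-hand side [b] of a facet-defining
inequality nonnegative, and [b = 0] would make the functional vanish on the
whole polytope.  Once [b] is scaled to 1, [facet_clique] gives a clique constraint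
that is 1 at all generators of the facet, hence on the facet, and two
functionals equal to 1 on a set of dimension [n] coincide. *)
Lemma facetE F : face (Hans R G) F -> has_dim F #|vert G| ->
  exists q, clique q.2 /\ F = facet q.
Proof.
case=> a [b [ab FE]] dF.
have hullT : forall k, has_dim (Hans R G) k <-> k = (#|vert G| + 1)%N.
  by apply: has_dim_full; apply: aff_hull_Hans.
have genP p : stable p.2 -> Hans R G (gen p).
  by move=> sp; rewrite HansE; apply: sub_conv_hull; exists p.
have le p : stable p.2 -> `|dotp a (gen p)| <= b.
  case: p => c S /= sS;
    rewrite ler_norml -[X in X && _]lerN2 opprK -dotpNr -genN.
  by rewrite !ab //; apply: genP.
have leV w : vertices w -> dotp a w <= b.
  by case=> p /= sp <-; apply: le_trans (le p sp); apply: ler_norm.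
have tight x : F x -> conv_hull (vertices `&` [set x | dotp a x = b]) x.
  by rewrite FE => -[]; rewrite HansE => xP ax; apply: conv_hull_face.
have b_ge0 : 0 <= b.
  by apply: le_trans (le (true, simplex_set None) (stable_simplex _)).
have b_neq0 : b != 0.
  apply/eqP => b0; have FP : F = Hans R G.
    rewrite FE; apply/seteqP; split=> x /=; first by case.
    move=> xP; split=> //; rewrite HansE in xP.
    apply: (aff_hull_eq (A := vertices)).
      move=> _ [p /= sp <-]; apply/eqP; rewrite b0 -normr_le0 -b0; exact: le.
    by have [n [c [q [qA _ c1 ->]]]] := xP; exists n, c, q.
  by move: dF; rewrite FP hullT; lia.
have b_gt0 : 0 < b by rewrite lt_def b_neq0.
pose a1 := b^-1 *: a.
have a1F x : F x -> dotp a1 x = 1.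
  by rewrite FE => -[_ /= e]; rewrite dotpZl e mulVf.
have a1gen p : dotp a1 (gen p) = sgn p.1 * functional (vcoord a1) (hcoord a1)
  p.2.
  exact: dotp_gen.
have bnd S : stable S -> `|functional (vcoord a1) (hcoord a1) S| <= 1.
  move=> sS; have := a1gen (true, S); rewrite mul1r => <-.
  rewrite dotpZl normrM normfV (gtr0_norm b_gt0) ler_pdivrMl // mulr1.
  exact: (le (true, S)).
have [c [K [cK cKS]]] := facet_clique perfG bnd.
exists (c, K); split=> //.
have kF x : F x -> dotp (clique_functional (c, K)) x = 1.
  move/tight => [n [d [p [pA _ d1 ->]]]].
  apply: (aff_hull_eq (A := vertices `&` [set x | dotp a x = b])); last first.
    by exists n, d, p.
  move=> _ [[q sq <-] /= aq]; rewrite clique_functional_gen //=.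
  rewrite (cKS q.1 q.2) ?eqxx // -a1gen dotpZl aq mulVf //.
have ak : forall x, dotp a1 x = dotp (clique_functional (c, K)) x.
  by apply: (hyperplane_unique (A := F)) => //;
    rewrite [X in has_dim _ X.-1]addn1.
rewrite FE /facet; congr (_ `&` _); apply/seteqP; split=> x /=;
  rewrite -ak dotpZl.
  by move->; rewrite mulVf.
by move/(congr1 ( *%R b)); rewrite mulrA mulfV // mul1r mulr1.
Qed.

Lemma facet_faces :
  [set F | face (Hans R G) F /\ has_dim F #|vert G|] =
  [set facet q | q in [set q | q \in [set q : bool * {set G} | clique
    q.2]%SET]].
Proof.
apply/seteqP; split=> F /=.
  by case=> fF /(facetE fF)[q [cq ->]]; exists q; rewrite ?inE.
by case=> q; rewrite inE => cq <-; split;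
  [apply: facet_face|apply: has_dim_facet].
Qed.

Lemma face_number_facets : face_number (Hans R G) #|vert G| = (2 * #|cliques
  G|)%N.
Proof.
rewrite /face_number facet_faces card_fset_set_image ?card_signed_cliques //.
exact: facet_inj.
Qed.

End HansenPolytope.

(** * Edgeless and complete graphs *)

Section Models.
Variables (R : realType) (G : sgraph).
Notation n := #|vert G|.
Notation V := 'rV[R]_(n + 1).

(** Both models are images of a Hansen polytope under such a map:
[shear 2 (-1) 0] sends [(x, t)] to [(2 x - t, t)], and [shear 1 0 (-1)] sends it
to its coordinates in the basis of generators of the empty set and the
singletons. *)
Definition shear (al be ga : R) : 'M[R]_(n + 1) :=
  block_mx al%:M (const_mx ga) (const_mx be) 1%:M.

Lemma vcoord_shear al be ga (x : V) v :
  vcoord (x *m shear al be ga) v = al * vcoord x v + be * hcoord x.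
Proof.
rewrite /shear -[x]hsubmxK mul_row_block vcoord_row mxE vcoord_row hcoord_row.
by rewrite mul_mx_scalar !mxE big_ord1 !mxE [be * _]mulrC.
Qed.

Lemma hcoord_shear al be ga (x : V) :
  hcoord (x *m shear al be ga) = ga * (\sum_v vcoord x v) + hcoord x.
Proof.
rewrite /shear -{1}[x]hsubmxK mul_row_block hcoord_row mulmx1 !mxE.
congr (_ + _); rewrite mulr_sumr.
rewrite -(sum_enum_val (fun v => ga * vcoord x v)); apply: eq_bigr => i _.
by rewrite !mxE mulrC /vcoord enum_valK.
Qed.

Lemma cubeP (z : V) :
  cube R (n + 1) z <-> (forall v, `|vcoord z v| <= 1) /\ `|hcoord z| <= 1.
Proof.
split=> [H|[Hv Hh] i].
  by split=> [v|]; rewrite ler_norml; apply: H.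
rewrite -ler_norml; have [j|j] := split_ordP i => ->.
  by rewrite -[j]enum_valK; apply: Hv.
by rewrite [j]ord1; apply: Hh.
Qed.

Lemma sum_prod_sets (f g : G -> R) :
  \sum_(S : {set G}) \prod_v (if v \in S then f v else g v) =
  \prod_v (f v + g v).
Proof. by rewrite bigA_distr. Qed.

(** The clique constraints of singletons and of the empty set bound the image by
the cube.  Conversely, a point of the cube is the mean of the sign vectors for
the product distribution with independent coordinates, and every sign vector is
the image of a generator. *)
Lemma edgeless_cube : edgeless G -> aff_isomorphic (Hans R G) (cube R (n + 1)).
Proof.
move=> eG; exists (shear 2 (-1) 0), 0; split.
- move=> x Px; rewrite addr0; apply/cubeP.
  have cq q : clique q.2 -> dotp (clique_functional R q) x <= 1.
    by move=> ?; apply: clique_functional_le.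
  have cE b (S : {set G}) : dotp (clique_functional R (b, S)) x =
      sgn b * (2 * \sum_(v in S) vcoord x v - hcoord x).
    rewrite dotp_coord hcoord_pt mulrBr mulNr; congr (_ - _).
    rewrite mulr_sumr mulr_sumr [RHS]big_mkcond; apply: eq_bigr => v _ /=.
    by rewrite vcoord_pt /=; case: (v \in S) => /=; ring.
  split=> [v|].
    have c1 : clique [set v]%SET by apply: clique_card_le1; rewrite cards1.
    have := cq (true, _) c1; have := cq (false, _) c1.
    rewrite !cE big_set1 vcoord_shear ler_norml /sgn; lra.
  have c0 : clique (finset.set0 : {set G}) by apply: clique_card_le1;
    rewrite cards0.
  have := cq (true, _) c0; have := cq (false, _) c0.
  by rewrite !cE big_set0 hcoord_shear ler_norml /sgn; lra.
- move=> x y _ _; rewrite !addr0 => e.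
  have h : hcoord x = hcoord y.
    by have := congr1 (@hcoord R G) e; rewrite !hcoord_shear !mul0r !add0r.
  apply: pt_eq => // v; have := congr1 (fun z => vcoord z v) e.
  by rewrite !vcoord_shear h => /addIr /mulfI; apply; rewrite pnatr_eq0.
move=> z /cubeP[zv zh].
pose s v := vcoord z v; pose t := hcoord z.
exists (pt (fun v => (s v + t) / 2) t); last first.
  rewrite addr0; apply: pt_eq => [v|].
    by rewrite vcoord_shear vcoord_pt hcoord_pt; rewrite /s /t; field.
  by rewrite hcoord_shear hcoord_pt mul0r add0r.
(* Probability that v is in S, resp. not in S, given the sign b. *)
pose f b v : R := (1 + sgn b * s v) / 2.
pose g b v : R := (1 - sgn b * s v) / 2.
pose lam (p : bool * {set G}) : R := (1 + sgn p.1 * t) / 2 *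
  \prod_v (if v \in p.2 then f p.1 v else g p.1 v).
have fg b v : f b v + g b v = 1 by rewrite /f /g; field.
have range (u : R) b : `|u| <= 1 -> 0 <= 1 + sgn b * u /\ 0 <= 1 - sgn b * u.
  by rewrite ler_norml => /andP[? ?]; case: b; rewrite /sgn; split; lra.
have sum1 b : \sum_(S : {set G}) lam (b, S) = (1 + sgn b * t) / 2.
  by rewrite /lam /= -mulr_sumr sum_prod_sets big1 ?mulr1 // => v _; apply: fg.
have sumv b v : \sum_(S : {set G}) lam (b, S) * (v \in S)%:R =
    (1 + sgn b * t) / 2 * f b v.
  rewrite (eq_bigr (fun S : {set G} => (1 + sgn b * t) / 2 *
    \prod_u (if u \in S then f b u else if u == v then 0 else g b u))).
    rewrite -mulr_sumr sum_prod_sets (bigD1 v) //= eqxx addr0 big1 ?mulr1 //.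
    by move=> u /negPf ->; apply: fg.
  move=> S _; rewrite /lam /= -[LHS]mulrA; congr (_ * _).
  rewrite (bigD1 v) //= [RHS](bigD1 v) //= eqxx.
  case: (v \in S); rewrite ?mulr0 ?mul0r // mulr1; congr (_ * _).
  by apply: eq_bigr => u /negPf ->.
have sum_pair (F : bool * {set G} -> R) :
    \sum_p F p = \sum_S F (true, S) + \sum_S F (false, S).
  by rewrite -(big_bool _ (fun b => \sum_S F (b, S))) pair_bigA;
    apply: eq_bigr => -[].
have -> : pt (fun v => (s v + t) / 2) t = \sum_p lam p *: gen R p.
  apply: pt_eq => [v|].
    rewrite vcoord_sum vcoord_pt sum_pair.
    under eq_bigr do rewrite vcoord_pt /= mul1r.
    under [X in _ = _ + X]eq_bigr do rewrite vcoord_pt /= mulN1r mulrN.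
    by rewrite sumrN !sumv /f /sgn; field.
  rewrite hcoord_sum hcoord_pt sum_pair.
  under eq_bigr do rewrite hcoord_pt /= mulr1.
  under [X in _ = _ + X]eq_bigr do rewrite hcoord_pt /= mulrN1.
  by rewrite sumrN !sum1 /sgn; field.
rewrite HansE; apply: conv_hull_fin => [p|[b S]|].
- by exists p => //; apply/stableP => x y _ _; apply: eG.
- apply: mulr_ge0; first by rewrite divr_ge0 //; have [] := range _ b zh.
  apply: prodr_ge0 => v _; have [? ?] := range _ b (zv v).
  by case: ifP => _; rewrite divr_ge0.
by rewrite sum_pair !sum1 /sgn; field.
Qed.

Lemma complete_stable_simplex (S : {set G}) : complete G -> stable S ->
  exists o, S = simplex_set o.
Proof.
move=> cG /stableP sS; have [->|[v vS]] := set_0Vmem S; first by exists None.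
exists (Some v); apply/setP => u; rewrite inE; apply/idP/eqP => [uS|->] //.
by apply/eqP; apply: contraT => /cG uv; have := sS _ _ uS vS; rewrite uv.
Qed.

(** The generators are sent to the signed unit vectors.  Testing a point [z] of
the cross-polytope against its own sign vector shows that the absolute values
of its coordinates have sum at most 1; the slack is spread evenly over all
antipodal pairs of generators, where it cancels. *)
Lemma complete_cross :
  complete G -> aff_isomorphic (Hans R G) (cross_polytope R (n + 1)).
Proof.
move=> cG; exists (shear 1 0 (-1)), 0; split.
- move=> x Px; rewrite addr0 => u /cubeP[uv uh].
  have -> y : dotp u (y *m shear 1 0 (-1)) = dotp (u *m (shear 1 0 (-1))^T) y.
    by rewrite !dotpE trmx_mul trmxK mulmxA.
  rewrite HansE in Px; apply: conv_hull_le Px => _ [[b S] /= sS <-].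
  have -> y : dotp (u *m (shear 1 0 (-1))^T) y = dotp u (y *m shear 1 0 (-1)).
    by rewrite !dotpE trmx_mul trmxK mulmxA.
  have le1 (w : R) : `|w| <= 1 -> sgn b * w <= 1.
    by rewrite ler_norml => /andP[? ?]; case: (b); rewrite /sgn; lra.
  rewrite dotp_coord hcoord_shear hcoord_pt.
  under eq_bigr do rewrite vcoord_shear mul1r mul0r addr0 vcoord_pt /=.
  under [X in _ * (_ * X + _)]eq_bigr do rewrite vcoord_pt /=.
  have [[w|] ->] := complete_stable_simplex cG sS.
    rewrite (bigD1 w) //= big1 => [|v vw];
      last by rewrite inE (negPf vw) !mulr0.
    rewrite [X in _ * (_ * X + _)](bigD1 w) //= big1 => [|v vw].
      by rewrite inE eqxx !addr0 !mulr1 mulN1r addNr mulr0 addr0 mulrC;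
        apply: le1.
    by rewrite inE (negPf vw) mulr0.
  rewrite big1 => [|v _]; last by rewrite inE !mulr0.
  rewrite big1 => [|v _]; last by rewrite inE mulr0.
  by rewrite mulr0 !add0r mulrC; apply: le1.
- move=> x y _ _; rewrite !addr0 => e.
  have v : vcoord x =1 vcoord y.
    move=> v; have := congr1 (fun z => vcoord z v) e.
    by rewrite !vcoord_shear !mul0r !addr0 !mul1r.
  apply: pt_eq => //; have := congr1 (@hcoord R G) e; rewrite !hcoord_shear.
  by rewrite (eq_bigr _ (fun u _ => v u)) => /addrI.
move=> z zP; pose x := pt (vcoord z) (hcoord z + \sum_v vcoord z v).
exists x; last first.
  rewrite addr0; apply: pt_eq => [v|].
    by rewrite vcoord_shear vcoord_pt mul1r mul0r addr0.
  rewrite hcoord_shear hcoord_pt; under eq_bigr do rewrite vcoord_pt.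
  by rewrite mulN1r addrC addrK.
pose zeta o := simplex_coord x o.
have zetaE : zeta None = hcoord z.
  rewrite /zeta /= hcoord_pt; under [X in _ - X]eq_bigr do rewrite vcoord_pt.
  by rewrite addrK.
have zeta1 : \sum_o `|zeta o| <= 1.
  have := zP (pt (fun v => Num.sg (vcoord z v)) (Num.sg (hcoord z))) _.
  rewrite dotp_coord hcoord_pt big_option zetaE;
    under eq_bigr do rewrite vcoord_pt.
  rewrite -normrEsg; under eq_bigr do rewrite -normrEsg.
  under [X in _ -> X + _ <= _]eq_bigr do rewrite /zeta /= vcoord_pt.
  apply; apply/cubeP; split=> [v|]; rewrite ?vcoord_pt ?hcoord_pt normr_sg;
  by case: (_ != 0); rewrite ?ler01.
pose r := (1 - \sum_o `|zeta o|) / (2 * n.+1%:R).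
pose w (p : bool * option G) := (`|zeta p.2| + sgn p.1 * zeta p.2) / 2 + r.
have -> : x = \sum_p w p *: gen R (p.1, simplex_set p.2).
  rewrite -(pair_bigA _ (fun b o => w (b, o) *: gen R (b, simplex_set o))) /=
    big_bool.
  rewrite -big_split {1}[x](simplex_expand (fun=> true));
    apply: eq_bigr => o _ /=.
  rewrite (genN _ true) scalerN -scalerBl; congr (_ *: _).
  by rewrite /w -/(zeta o) /sgn /=; field.
rewrite HansE; apply: conv_hull_fin => [p|[b o]|].
- by exists (p.1, simplex_set p.2) => //; apply: stable_simplex.
- rewrite /w /r /= addr_ge0 // divr_ge0 ?ler0n ?mulr_ge0 ?subr_ge0 //.
  have := ler_norm (zeta o); have := ler_norm (- zeta o).
  by rewrite normrN /sgn; case: b; lra.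
rewrite -(pair_bigA _ (fun b o => w (b, o))) /= big_bool -big_split /=.
rewrite (eq_bigr (fun o => `|zeta o| + r * 2)) => [|o _];
  last by rewrite /w /sgn /=; field.
rewrite big_split /= sumr_const card_option -mulr_natr /r; field.
by rewrite addrC natr1 pnatr_eq0.
Qed.

Lemma card_extreme_iso (k : nat) (Q : set 'rV[R]_k) : aff_isomorphic (Hans R G)
  Q ->
  #|` fset_set (extreme Q)|%fset = (2 * #|stables G|)%N.
Proof.
case=> M [b bij]; have := bij; rewrite HansE => /extreme_aff_bij.
rewrite -HansE extreme_Hans => ->.
have -> : [set x *m M + b | x in @vertices R G] =
    [set gen R p *m M + b | p in [set p | p \in [set p : bool * {set G} |
      stable p.2]%SET]].
  rewrite /vertices image_comp; congr (_ @` _).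
  by apply/seteqP; split=> p /=; rewrite inE.
rewrite card_fset_set_image ?card_signed_stables // => p q sp sq e.
case: bij => _ inj _; apply: (@gen_inj R G).
have gP p' : p' \in [set p : bool * {set G} | stable p.2]%SET -> gen R p' \in
  Hans R G.
  rewrite inE => sp'; rewrite inE HansE; apply: sub_conv_hull; by exists p'.
exact: inj (gP _ sp) (gP _ sq) e.
Qed.

End Models.

(** The vertex type is a parameter, so that the Hansen polytope lives in the same
space as that of any other graph on these vertices. *)
Definition edgeless_graph (T : finType) : sgraph :=
  @SGraph T (fun _ _ => false) (fun _ _ => erefl) (fun _ => erefl).

Definition complete_graph (T : finType) : sgraph :=
  @SGraph T (fun x y => x != y) (fun x y => congr1 negb (eq_sym x y))
    (fun x => congr1 negb (eqxx x)).

(** The cube is also isomorphic to the Hansen polytope of the edgeless graph, so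
counting extreme points through the cube shows that all sets are stable. *)
Lemma iso_cube_edgeless (R : realType) (G : sgraph) :
  aff_isomorphic (Hans R G) (cube R (#|vert G| + 1)) -> edgeless G.
Proof.
pose G0 := edgeless_graph (vert G); have e0 : edgeless G0 by [].
move/card_extreme_iso; rewrite (card_extreme_iso (edgeless_cube R e0)) => e.
apply/edgeless_stables; move/edgeless_stables: e0 => e0.
by move/eqP: e; rewrite eqn_mul2l /= => /eqP <-.
Qed.

Lemma iso_cross_complete (R : realType) (G : sgraph) :
  aff_isomorphic (Hans R G) (cross_polytope R (#|vert G| + 1)) -> complete G.
Proof.
pose G0 := complete_graph (vert G); have e0 : complete G0 by [].
move/card_extreme_iso; rewrite (card_extreme_iso (complete_cross R e0)) => e.
apply/complete_stables; move/complete_stables: e0 => e0.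
by move/eqP: e; rewrite eqn_mul2l /= => /eqP <-.
Qed.

Theorem lemma8 (R : realType) (d : nat) (G : sgraph)
    (hd : (1 <= d)%N) (hG : #|vert G| = (d - 1)%N) (perfG : perfect G) :
  let P := Hans R G in
  [/\ has_dim P d,
      (face_number P 0 * face_number P (d - 1) <= d * 2 ^ (d + 1))%N
    & (face_number P 0 * face_number P (d - 1))%N = (d * 2 ^ (d + 1))%N <->
      aff_isomorphic P (cube R d) \/ aff_isomorphic P (cross_polytope R d)].
Proof.
move=> P; have dE : d = (#|vert G| + 1)%N by rewrite hG subnK.
rewrite -hG; clear hG hd; subst d.
rewrite /P face_number0 face_number_facets //.
have -> : (2 * #|stables G| * (2 * #|cliques G|))%N = (4 * (#|stables G| *
  #|cliques G|))%N.
  by rewrite mulnACA.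
have -> : ((#|vert G| + 1) * 2 ^ (#|vert G| + 1 + 1))%N = (4 * (#|vert G|.+1 *
  2 ^ #|vert G|))%N.
  by rewrite !addn1 !expnS !mulnA mulnC; lia.
split.
- by apply/has_dim_full => // x; apply: aff_hull_Hans.
- by rewrite leq_mul2l stables_cliques_le orbT.
split=> [/eqP|].
  rewrite eqn_mul2l /= => /eqP /stables_cliques_eq[eG|cG].
    by left; apply: edgeless_cube.
  by right; apply: complete_cross.
case=> [/iso_cube_edgeless eG|/iso_cross_complete cG]; congr (4 * _)%N.
  by rewrite (edgeless_stables G).1 // edgeless_cliques // mulnC.
by rewrite (complete_stables G).1 // complete_cliques.
Qed.
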